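(* Let $\mathcal T$ denote a tree with $N$ edges and two internal nodes, numbered $1$ and $2$, connecting $k_1$ and $k_2$ edges respectively, and assume that $\alpha_1\neq k_1$ and $\alpha_2\neq k_2$. Then the operator $A_T$ has at least one eigenvalue if, and only if, $$\alpha_1\neq k_1-2\quad\text{and}\quad\alpha_2\neq k_2-2 .$$ Furthermore, if $\alpha_1\ne k_1-2$ and $\alpha_2\ne k_2-2$, then the discrete spectrum of $A_T$ is $\sigma_d(A_T)=\{\lambda_k:\ k\in\mathbb Z\}$, where $$\lambda_k=\frac{c_2}{2}\log_{-\frac{\pi}{2}}\frac{(2+\alpha_1-k_1)(2+\alpha_2-k_2)}{(\alpha_1-k_1)(\alpha_2-k_2)}+ic_2k\pi .$$ In particular, in that case, the finite-time stability to constant functions does not hold for the system $U_t=A_TU$, $U(0)=U_0$. Finally, if $$(\alpha_1,\alpha_2)\in\big(\{k_1-2\}\times(\mathbb R\setminus\{k_2\})\big)\cup\big((\mathbb R\setminus\{k_1\})\times\{k_2-2\}\big),$$ then the finite-time stability to constant functions holds for this system.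
   Context: Setting. The tree has $N$ edges of length $1$, indexed by $i\in\mathcal I=\{1,\dots,N\}$ and parametrized by $x\in[0,1]$, with wave speeds $c_i>0$; $k_1\ge2$, $k_2\ge 2$, $k_1+k_2=N+1$. Edge $1$ goes from the root (an external node, $x=0$) to internal node $1$ ($x=1$). Edge $2$ goes from internal node $1$ ($x=0$) to internal node $2$ ($x=1$). Edges $3\le i\le k_1$ (none if $k_1=2$) go from internal node $1$ ($x=0$) to an external node ($x=1$). Edges $k_1+1\le i\le N$ go from internal node $2$ ($x=0$) to an external node ($x=1$). The unknowns satisfy $u_{i,tt}=c_i^2u_{i,xx}$ on each edge, transparent boundary conditions at all external nodes, continuity at the internal nodes, and the modified Kirchhoff law with coefficients $\alpha_1,\alpha_2\in\mathbb R$ at internal nodes $1,2$, all encoded in the operator below (with $v_i=u_{i,t}$ and $U=(u_i,v_i)_{i\in\mathcal I}$). Space and operator. $$\mathcal H=\Big\{(u_i,v_i)_{i\in\mathcal I}\in\prod_{i\in\mathcal I}[H^1(0,1)\times L^2(0,1)]:\ u_i(0)=u_1(1)\text{ for }2\le i\le k_1,\ u_i(0)=u_2(1)\text{ for }k_1+1\le i\le N\Big\}.$$ $A_T\big((u_i,v_i)_{i\in\mathcal I}\big)=(v_i,c_i^2u_i'')_{i\in\mathcal I}$, with domain the set of $(u_i,v_i)_{i\in\mathcal I}\in\prod_{i\in\mathcal I}[H^2(0,1)\times H^1(0,1)]$ such that $c_1u_1'(0)=v_1(0)$; $c_iu_i'(1)=-v_i(1)$ for $3\le i\le N$; $\sum_{2\le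 i\le k_1}c_iu_i'(0)-c_1u_1'(1)=-\alpha_1v_1(1)$; $\sum_{k_1+1\le i\le N}c_iu_i'(0)-c_2u_2'(1)=-\alpha_2v_2(1)$; $(u_i(0),v_i(0))=(u_1(1),v_1(1))$ for $2\le i\le k_1$; $(u_i(0),v_i(0))=(u_2(1),v_2(1))$ for $k_1+1\le i\le N$. When $\alpha_1\ne k_1$ and $\alpha_2\ne k_2$, $A_T$ generates a strongly continuous semigroup on $\mathcal H$, and solutions of $U_t=A_TU$, $U(0)=U_0\in\mathcal H$ are its trajectories. Eigenvalues are sought in $\mathbb C$, with complex-valued eigenfunctions. Conventions. The discrete spectrum $\sigma_d(A_T)$ is the set of (complex) eigenvalues of $A_T$. $\log_{-\pi/2}$ is the usual determination of the logarithm on $\mathbb C\setminus i\mathbb R^-$, with $\log_{-\pi/2}(z)=\log|z|$ for $z\in(0,+\infty)$ and $\log_{-\pi/2}(z)=\log|z|+i\pi$ for $z\in(-\infty,0)$. Finite-time stability to constant functions means that each solution becomes constant after some finite time: for every $U_0\in\mathcal H$ there are $T\ge0$ and a constant $C$ with $u_i(x,t)=C$ for all $i\in\mathcal I$, $x\in[0,1]$, $t\ge T$.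
   Formalization: Constant states (u_i=1, v_i=0) always lie in the kernel of A_T, so 0 is always an eigenvalue; the first claim is proved as ''A_T has at least one nonzero eigenvalue iff …'' and the spectrum as σ_d(A_T) = {0} ∪ {λ_k : k∈ℤ}. *)

(* Defs.v *)
From HB Require Import structures.
From mathcomp Require Import all_boot all_order all_algebra.
From mathcomp Require Import all_classical all_reals all_analysis.
From mathcomp Require Import complex.
Set Implicit Arguments.
Unset Strict Implicit.
Unset Printing Implicit Defensive.
Import Order.TTheory GRing.Theory Num.Theory.
Import numFieldNormedType.Exports.
Local Open Scope classical_set_scope.
Local Open Scope complex_scope.
Local Open Scope ring_scope.

(* The components of R[i], as elements of R. *)
Local Notation Re := complex.Re.
Local Notation Im := complex.Im.

Section ComplexFunctions.
Context {R : realType}.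
Local Notation mu := (@lebesgue_measure R).
Local Notation I01 := (`[0, 1]%classic : set R).
Implicit Types (f g u : R -> R[i]) (z w : R[i]).

Definition sqmod z : R := Re z ^+ 2 + Im z ^+ 2.

Definition cexp w : R[i] := expR (Re w) * cos (Im w) +i* (expR (Re w) * sin (Im w)).

(* The determination of the logarithm with cut along the negative imaginary
   half-axis: the imaginary part is taken in ]-pi/2, 3pi/2[. Junk value 0 on
   the cut. *)
Definition log_mpi2 z : R[i] :=
  xget 0 [set w | cexp w = z /\ - (pi / 2) < Im w < 3 * pi / 2].

(* Functions on (0,1) are represented by functions on R, of which only the
   restriction to [0,1] matters. Elements of L^2 are handled through
   representatives, up to equality almost everywhere. *)
Definition L2 f : Prop :=
  [/\ measurable_fun I01 (fun x => Re (f x)),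
      measurable_fun I01 (fun x => Im (f x)) &
      (\int[mu]_(x in I01) (sqmod (f x))%:E < +oo)%E].

Definition L2sq f : R := \int[mu]_(x in I01) sqmod (f x).

Definition primitive0 g (x : R) : R[i] :=
  (\int[mu]_(t in `[0%R, x]) Re (g t)) +i* (\int[mu]_(t in `[0%R, x]) Im (g t)).

(* u is the absolutely continuous representative of an element of H^1(0,1)
   with derivative g in L^2(0,1); in particular u is continuous on [0,1], so
   that its values at 0 and 1 are the traces. *)
Definition is_wderiv u g : Prop :=
  L2 g /\ forall x, I01 x -> u x = u 0 + primitive0 g x.

Definition H1 u : Prop := exists g, is_wderiv u g.

Definition H2 u : Prop := exists g, is_wderiv u g /\ H1 g.

(* A version of the derivative of a function in H^1 (unique up to equality
   almost everywhere), and the continuous version of the derivative of a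
   function in H^2 (unique on [0,1]), which has values at 0 and 1. *)
Definition wderiv u : R -> R[i] := xget (fun=> 0) [set g | is_wderiv u g].

Definition cderiv u : R -> R[i] :=
  xget (fun=> 0) [set g | is_wderiv u g /\ H1 g].

End ComplexFunctions.

(* A family (u_i, v_i) indexed by the edges. *)
Definition state (R : realType) (N : nat) : Type :=
  'I_N -> (R -> R[i]) * (R -> R[i]).

(* The ordinal i : 'I_N stands for the edge numbered i + 1. *)
Definition label (N : nat) (i : 'I_N) : nat := i.+1.

Section Network.
Context {R : realType} {N : nat}.
Variables (k1 k2 : nat) (e1 e2 : 'I_N) (c : 'I_N -> R) (alpha1 alpha2 : R).
Local Notation mu := (@lebesgue_measure R).
Local Notation I01 := (`[0, 1]%classic : set R).
Implicit Types (U W : state R N) (S : R -> state R N -> state R N).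

(* The edges leaving internal node 1 and internal node 2. *)
Definition out1 (i : 'I_N) : bool := (2 <= label i <= k1)%N.
Definition out2 (i : 'I_N) : bool := (k1 + 1 <= label i <= N)%N.

Definition inH U : Prop :=
  [/\ forall i, H1 (U i).1 /\ L2 (U i).2,
      forall i, out1 i -> (U i).1 0 = (U e1).1 1 &
      forall i, out2 i -> (U i).1 0 = (U e2).1 1].

(* Equality as elements of the product of the spaces H^1 x L^2. *)
Definition eqH U W : Prop :=
  forall i, (forall x, I01 x -> (U i).1 x = (W i).1 x) /\ ae_eq mu I01 (U i).2 (W i).2.

Definition normH U : R :=
  Num.sqrt (\sum_i (L2sq (U i).1 + L2sq (wderiv (U i).1) + L2sq (U i).2)).

Definition scaleH (a : R[i]) U : state R N :=
  fun i => ((fun x => a * (U i).1 x), (fun x => a * (U i).2 x)).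

Definition AT U : state R N :=
  fun i => ((U i).2,
            (fun x => (c i ^+ 2)%:C * wderiv (cderiv (U i).1) x)).

Definition domAT U : Prop :=
  let u' i := cderiv (U i).1 in let v i := (U i).2 in
  (forall i, H2 (U i).1 /\ H1 (U i).2) /\
  [/\ (c e1)%:C * u' e1 0 = v e1 0,
      forall i, (3 <= label i <= N)%N -> (c i)%:C * u' i 1 = - v i 1,
      \sum_(i | out1 i) (c i)%:C * u' i 0 - (c e1)%:C * u' e1 1
        = - alpha1%:C * v e1 1 &
      \sum_(i | out2 i) (c i)%:C * u' i 0 - (c e2)%:C * u' e2 1
        = - alpha2%:C * v e2 1] /\
  [/\ forall i, out1 i -> (U i).1 0 = (U e1).1 1 /\ v i 0 = v e1 1 &
      forall i, out2 i -> (U i).1 0 = (U e2).1 1 /\ v i 0 = v e2 1].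

Definition is_eigenvalue (lambda : R[i]) : Prop :=
  exists U, [/\ domAT U, ~ eqH U 0 & eqH (AT U) (scaleH lambda U)].

(* The constant functions (u_i = 1, v_i = 0) lie in the kernel of AT, so that 0
   always belongs to sigma_d, whatever alpha1 and alpha2. *)
Definition sigma_d : set R[i] := [set lambda | is_eigenvalue lambda].

(* Strongly continuous semigroups of bounded linear operators on H. They act
   on representatives; compatibility with eqH follows from linearity and
   boundedness. *)
Record C0_semigroup S : Prop := {
  sg_stable : forall t U, 0 <= t -> inH U -> inH (S t U);
  sg_linear : forall t a U W, 0 <= t -> inH U -> inH W ->
    eqH (S t (scaleH a U + W)) (scaleH a (S t U) + S t W);
  sg_bounded : forall t, 0 <= t ->
    exists M, forall U, inH U -> normH (S t U) <= M * normH U;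
  sg_zero : forall U, inH U -> eqH (S 0 U) U;
  sg_add : forall s t U, 0 <= s -> 0 <= t -> inH U ->
    eqH (S (s + t) U) (S s (S t U));
  sg_continuous : forall U, inH U -> normH (S t U - U) @[t --> 0^'+] --> 0 }.

(* The infinitesimal generator of S is AT. The domain of AT is a set of
   classes for eqH, of which domAT selects the representatives (U, V) with
   all the V i continuous. *)
Definition generates S : Prop :=
  forall U W, inH U -> inH W ->
    (normH (scaleH (h^-1)%:C (S h U - U) - W) @[h --> 0^'+] --> 0) <->
    exists U', [/\ eqH U U', domAT U' & eqH (AT U') W].

Definition semigroup_of_AT S : Prop := C0_semigroup S /\ generates S.

(* Finite-time stability to constant functions of the trajectories of S. *)
Definition finite_time_stable S : Prop :=
  forall U0, inH U0 -> exists2 T : R, 0 <= T & exists C : R[i],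
    forall t, T <= t -> forall i x, I01 x -> (S t U0 i).1 x = C.

End Network.

Definition lambda_ (R : realType) (k1 k2 : nat) (c2 alpha1 alpha2 : R) (k : int)
    : R[i] :=
  (c2 / 2)%:C *
    log_mpi2 (((2 + alpha1 - k1%:R) * (2 + alpha2 - k2%:R)) /
              ((alpha1 - k1%:R) * (alpha2 - k2%:R)))%:C
  + (0 +i* (c2 * k%:~R * pi)).

(* Main.v *)
Require Import Defs.
From HB Require Import structures.
From mathcomp Require Import all_boot all_order all_algebra.
From mathcomp Require Import all_classical all_reals all_analysis.
From mathcomp Require Import measurable_realfun complex.
From mathcomp Require Import ring lra zify.
Set Implicit Arguments.
Unset Strict Implicit.
Unset Printing Implicit Defensive.
Import Order.TTheory GRing.Theory Num.Theory.
Import numFieldNormedType.Exports.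
Local Open Scope classical_set_scope.
Local Open Scope complex_scope.
Local Open Scope ring_scope.
Local Notation Re := complex.Re.
Local Notation Im := complex.Im.

(** On an edge, let r be one of the two numbers c and -c.  The equation
u_tt = c^2 u_xx says that the Riemann invariant r u' + v is transported without
deformation with velocity -r: the invariant for r = c travels towards x = 0,
the one for r = -c towards x = 1.  The transparent conditions say that no
invariant enters through an external node.  At the internal nodes, when nothing
comes from the external edges, the conditions reduce to
c_2 u_2' = (k_1 - 1 - alpha_1) v_2 at the beginning of the middle edge and
c_2 u_2' = (alpha_2 - k_2 + 1) v_2 at its end ([node1_middle_slope] and
[node2_middle_slope]).  So a wave on the middle edge is reflected at node j with
coefficient (2 + alpha_j - k_j) / (alpha_j - k_j) up to sign, and everything
depends on whether one of these coefficients vanishes.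

Spectrum.  For an eigenvector v = lambda u, so each invariant solves a scalar
equation y' = (lambda / r) y and is an exponential ([eigen_riemann]).  For
lambda <> 0 an eigenvector is determined by its invariants on the middle edge,
and a round trip gives exp (2 lambda / c_2) = rho, where rho is the product of
the two reflection coefficients; conversely each solution of this equation, and
lambda = 0, gives an explicit eigenvector ([nonzero_eigenvalue_equation],
[eigenvalue_of_equation]).  Solving it with the logarithm yields [spectrumE].

Trajectories.  Only the right derivative of an orbit is controlled by the
generator, so the orbits must first be shown to be continuous.  Right continuity
is immediate.  A right-continuous orbit has, by the Baire theorem, a continuity
point in every interval, and applying one more bounded operator propagates
continuity to all later times ([orbit_continuous]).  Quantities computed along
an orbit are then continuous functions with a known right derivative, and a
continuous function with zero right derivative is constant ([rder0_const]).

Instability.  Along the orbit of an eigenvector, each value u_i(x) solves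
y' = lambda y, hence equals exp (lambda t) u_i(x); this does not become
constant when lambda <> 0.

Stability.  For V in the domain, the transport of the invariants of S(t)V holds
pointwise ([riemann_transport]).  It is proved on the primitive
r u(x) + int_0^x v, which is controlled uniformly by the norm of the energy
space: followed along the characteristics its right derivative does not depend
on the characteristic.  If one reflection coefficient vanishes, the invariants
that start from external nodes die first, then one after the other the two
invariants of the middle edge, then the remaining ones, each step lasting at
most sum_i 1 / c_i; so the
velocity of S(t)V, which is the first component of S(t)AV, vanishes after four
times that delay.  Finally each state is the sum of a constant state and of an
element AV of the range of A ([kernel_plus_range]): constants are fixed by S,
so the first component of its orbit is eventually constant. *)

(** * Primitives of integrable functions on [0,1] *)

Section RealPrimitives.
Context {R : realType}.
Local Notation mu := (@lebesgue_measure R).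
Local Notation I01 := (`[0, 1]%classic : set R).
Implicit Types (f g : R -> R) (x y a : R).

Definition integrable01 f := mu.-integrable I01 (EFin \o f).

Definition prim f x : R := \int[mu]_(t in `[0, x]) f t.

Definition sqint f := measurable_fun I01 f /\ integrable01 (fun x => f x ^+ 2).

Definition sqnorm f : R := \int[mu]_(x in I01) f x ^+ 2.

Lemma measurable01 : measurable I01. Proof. exact: measurable_itv. Qed.
Hint Resolve measurable01 : core.

Lemma mu01 : mu I01 = 1%E.
Proof. by rewrite lebesgue_measure_itv/= lte01 oppr0 adde0. Qed.

Lemma integrable01_cst a : integrable01 (cst a).
Proof.
apply: measurable_bounded_integrable => //; last exact: bounded_cst.
by have := ltry (1 : R); rewrite -mu01; apply.
Qed.

Lemma integrable01D f g : integrable01 f -> integrable01 g ->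
  integrable01 (fun x => f x + g x).
Proof.
move=> fi gi; rewrite /integrable01.
rewrite (_ : EFin \o _ = (EFin \o f) \+ (EFin \o g))%E; last exact/funext.
exact: integrableD.
Qed.

Lemma integrable01Z a f : integrable01 f -> integrable01 (fun x => a * f x).
Proof.
move=> fi; rewrite /integrable01.
rewrite (_ : EFin \o _ = (fun x => a%:E * (EFin \o f) x)%E); last exact/funext.
exact: integrableZl.
Qed.

Lemma integrable01_sub f x : integrable01 f -> x <= 1 ->
  mu.-integrable `[0, x] (EFin \o f).
Proof.
move=> fi x1; apply: integrableS fi => //.
by apply: subset_itvl; rewrite bnd_simp.
Qed.

Lemma primD f g x : integrable01 f -> integrable01 g -> x <= 1 ->
  prim (fun t => f t + g t) x = prim f x + prim g x.
Proof. by move=> fi gi x1; rewrite /prim RintegralD//; exact: integrable01_sub. Qed.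

Lemma primZ a f x : integrable01 f -> x <= 1 ->
  prim (fun t => a * f t) x = a * prim f x.
Proof. by move=> fi x1; rewrite /prim RintegralZl//; exact: integrable01_sub. Qed.

Lemma prim_cst a x : 0 <= x -> prim (cst a) x = a * x.
Proof.
move=> x0; rewrite /prim Rintegral_cst//; congr (_ * _).
have : fine (mu `[0, x]) = x; last by [].
rewrite lebesgue_measure_itv/= lte_fin; case: ltP => /=; first by rewrite subr0.
by move=> x0'; apply/eqP; rewrite eq_le x0 x0'.
Qed.

Lemma eq_prim f g x : x <= 1 -> (forall t, I01 t -> f t = g t) ->
  prim f x = prim g x.
Proof.
move=> x1 fg; apply: eq_Rintegral => t; rewrite inE/= in_itv/= => /andP[t0 tx].
by apply: fg; rewrite /= in_itv/= t0 (le_trans tx).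
Qed.

Lemma prim0 f : prim f 0 = 0.
Proof. by rewrite /prim set_itv1 Rintegral_set1. Qed.

Lemma prim_dist_le f x y M : integrable01 f -> 0 <= x -> x <= y -> y <= 1 ->
  (forall t, x <= t <= y -> `|f t| <= M) ->
  `|prim f y - prim f x| <= M * (y - x).
Proof.
move=> fi x0 xy y1 fM.
have fiy : mu.-integrable `]x, y] (EFin \o f).
  apply: integrableS fi => //.
  by apply: subset_itv; rewrite bnd_simp.
rewrite /prim Rintegral_itvB; last 3 first.
- exact: integrable01_sub.
- by rewrite bnd_simp.
- by rewrite bnd_simp.
apply: (le_trans (le_normr_Rintegral _ _)) => //.
have muxy : fine (mu `]x, y]) = y - x.
  rewrite lebesgue_measure_itv/= lte_fin; case: ltP => //= yx.
  by apply/esym/eqP; rewrite subr_eq0 eq_le xy yx.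
rewrite -muxy -Rintegral_cst//.
apply: le_Rintegral => //.
- by apply: integrable_norm.
- apply: measurable_bounded_integrable => //; last exact: bounded_cst.
  have : (mu `]x, y] < +oo)%E.
    by rewrite lebesgue_measure_itv/=; case: ifP => _; rewrite -?EFinD ltry.
  by apply.
- by move=> t; rewrite /= in_itv/= => /andP[xt ty]; apply: fM; rewrite (ltW xt).
Qed.

Lemma sqint_integrable f : sqint f -> integrable01 f.
Proof.
move=> [mf f2].
have h : integrable01 (fun x => 1 + f x ^+ 2).
  by apply: integrable01D => //; exact: (integrable01_cst 1).
apply: le_integrable h => //; first exact/measurable_EFinP.
move=> x _ /=; rewrite lee_fin.
have f0 : 0 <= f x ^+ 2 by rewrite sqr_ge0.
rewrite [leRHS]ger0_norm ?addr_ge0//.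
rewrite ler_norml; apply/andP; split; nra.
Qed.

Lemma sqintZ a f : sqint f -> sqint (fun x => a * f x).
Proof.
move=> [mf f2]; split; first by apply: measurable_funM => //.
rewrite (_ : (fun x => (a * f x) ^+ 2) = (fun x => a ^+ 2 * f x ^+ 2)).
  exact: integrable01Z.
by apply/funext => x; rewrite exprMn.
Qed.

Lemma sqintD f g : sqint f -> sqint g -> sqint (fun x => f x + g x).
Proof.
move=> [mf f2] [mg g2]; have mfg : measurable_fun I01 (fun x => f x + g x).
  exact: measurable_funD.
split => //.
have h : integrable01 (fun x => 2 * f x ^+ 2 + 2 * g x ^+ 2).
  by apply: integrable01D; exact: integrable01Z.
apply: le_integrable h => //.
  by apply/measurable_EFinP; exact: measurable_funX.
move=> x _ /=; rewrite lee_fin !ger0_norm ?sqr_ge0//; last first.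
  by rewrite addr_ge0// mulr_ge0// sqr_ge0.
have : 0 <= (f x - g x) ^+ 2 by rewrite sqr_ge0.
by nra.
Qed.

Lemma sqnorm_ae f g : sqint f -> sqint g -> ae_eq mu I01 f g ->
  sqnorm f = sqnorm g.
Proof.
move=> [mf _] [mg _] fg; rewrite /sqnorm /Rintegral; congr fine.
apply: ae_eq_integral => //.
- by apply/measurable_EFinP; exact: measurable_funX.
- by apply/measurable_EFinP; exact: measurable_funX.
- by apply: filterS fg => x /= + Dx => ->.
Qed.

(** Cauchy-Schwarz against the constant 1, read off from the positivity of the
integral of (f - m)^2 where m is the integral of f. *)
Lemma prim_sq_le f x : sqint f -> 0 <= x <= 1 -> prim f x ^+ 2 <= sqnorm f.
Proof.
move=> hf /andP[x0 x1]; set m := prim f x.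
have fi := sqint_integrable hf; case: (hf) => mf f2.
pose h t := f t ^+ 2 + (- (2 * m) * f t + m ^+ 2).
have hi : integrable01 h.
  apply: integrable01D => //; apply: integrable01D; first exact: integrable01Z.
  exact: (integrable01_cst (m ^+ 2)).
have h0 : 0 <= prim h x.
  apply: Rintegral_ge0 => t _.
  have -> : h t = (f t - m) ^+ 2 by rewrite /h; ring.
  exact: sqr_ge0.
have : prim h x = prim (fun t => f t ^+ 2) x - 2 * m * m + m ^+ 2 * x.
  rewrite /h primD//; last first.
    apply: integrable01D; first exact: integrable01Z.
    exact: (integrable01_cst (m ^+ 2)).
  rewrite primD//; [|exact: integrable01Z|exact: (integrable01_cst (m ^+ 2))].
  by rewrite primZ// (prim_cst (m ^+ 2))// -/m; ring.
move=> hE; rewrite hE in h0.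
have le2 : prim (fun t => f t ^+ 2) x <= sqnorm f.
  rewrite /prim /sqnorm /Rintegral fine_le//.
  - by apply: integrable_fin_num => //; exact: integrable01_sub.
  - by apply: integrable_fin_num.
  apply: ge0_subset_integral => //=.
  - by apply/measurable_EFinP; exact: measurable_funX.
  - by move=> t _; rewrite lee_fin sqr_ge0.
  - by apply: subset_itvl; rewrite bnd_simp.
have : m ^+ 2 * x <= m ^+ 2 by rewrite ler_piMr// sqr_ge0.
by nra.
Qed.

Lemma cont01_integrable f : {within I01, continuous f} -> integrable01 f.
Proof. by move=> cf; apply: continuous_compact_integrable => //; exact: segment_compact. Qed.

Lemma cont01_sqint f : {within I01, continuous f} -> sqint f.
Proof.
move=> cf; split; first exact: subspace_continuous_measurable_fun.
rewrite (_ : (fun x => f x ^+ 2) = (fun x => f x * f x)) //.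
by apply: cont01_integrable => x; apply: continuousM; exact: cf.
Qed.

Lemma prim_cont01 f : integrable01 f -> {within I01, continuous (prim f)}.
Proof. by move=> fi; apply: (@parameterized_integral_continuous R 0 1 f). Qed.

Lemma cont01P f : {within I01, continuous f} -> forall x e, I01 x -> 0 < e ->
  exists2 d, 0 < d & forall y, I01 y -> `|y - x| < d -> `|f y - f x| < e.
Proof.
move=> /subspace_continuousP cf x e xI e0.
have /cvgrPdist_lt/(_ _ e0) := cf x xI.
rewrite /= near_withinE => -[d /= d0 h]; exists d => // y yI yx.
by rewrite distrC; apply: h => //=; rewrite distrC.
Qed.

(** The fundamental theorem of calculus with the increment restricted to
[0,1]: this form covers both endpoints and is stable under composition with
moving points, whatever their direction. *)
Lemma prim_diff f x e : {within I01, continuous f} -> I01 x -> 0 < e ->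
  exists2 d, 0 < d & forall y, I01 y -> `|y - x| < d ->
    `|prim f y - prim f x - (y - x) * f x| <= e * `|y - x|.
Proof.
move=> cf xI e0; have fi := cont01_integrable cf.
have [d d0 h] := cont01P cf xI e0; exists d => // y yI yx.
pose g t := f t + - f x.
have gi : integrable01 g.
  by apply: integrable01D => //; exact: (integrable01_cst (- f x)).
have E z : I01 z -> prim f z = prim g z + f x * z.
  rewrite /= in_itv/= => /andP[z0 z1].
  rewrite /g primD//; last exact: (integrable01_cst (- f x)).
  by rewrite (prim_cst (- f x))//; ring.
rewrite (E y)// (E x)//.
have -> : prim g y + f x * y - (prim g x + f x * x) - (y - x) * f x =
  prim g y - prim g x by ring.
move: (xI) (yI); rewrite /= !in_itv/= => /andP[x0 x1] /andP[y0 y1].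
have gb t : Num.min x y <= t <= Num.max x y -> `|g t| <= e.
  move=> /andP[]; rewrite ge_min le_max => t1 t2.
  apply/ltW; apply: h.
    rewrite /= in_itv/=; apply/andP; split.
      by case/orP : t1; apply: le_trans.
    by case/orP : t2 => /le_trans; apply.
  apply: le_lt_trans yx; rewrite ler_norml.
  have := ler_norm (y - x); have := ler_norm (x - y); rewrite distrC.
  move: t1 t2; clear => /orP t1 /orP t2 h1 h2.
  by case: t1; case: t2 => *; apply/andP; split; lra.
have [xy|yx'] := leP x y.
  rewrite (ger0_norm (_ : 0 <= y - x)) ?subr_ge0//.
  apply: prim_dist_le => // t ht; apply: gb.
  by rewrite (min_idPl xy) (max_idPr xy).
rewrite distrC (ltr0_norm (_ : y - x < 0)) ?subr_lt0// opprB.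
apply: prim_dist_le => //; first exact: ltW.
move=> t ht; apply: gb.
by rewrite (min_idPr (ltW yx')) (max_idPl (ltW yx')).
Qed.

End RealPrimitives.

(** * A function is determined by its primitive *)

Section Uniqueness.
Context {R : realType}.
Local Notation mu := (@lebesgue_measure R).
Local Notation I01 := (`[0, 1]%classic : set R).
Implicit Types (f g : R -> R) (x y a : R).

(** Lebesgue differentiation, applied to the extensions by zero so that the
primitives coincide on the whole line. *)
Lemma prim_inj_ae f g : integrable01 f -> integrable01 g ->
  (forall x, I01 x -> prim f x = prim g x) -> ae_eq mu I01 f g.
Proof.
move=> fi gi fg.
have F (h : R -> R) : integrable01 h -> {ae mu, forall x,
    derive1 (fun x => \int[mu]_(t in `]-oo, x]) (h \_ I01) t) x =
    (h \_ I01) x}.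
  move=> hi.
  have hiR y : mu.-integrable `]-oo, y] (EFin \o (h \_ I01)).
    rewrite -restrict_EFin; apply/integrable_restrict => //.
    apply: integrableS hi => //; exact: measurableI.
  have := FTC1Ny hiR (integrable_locally (@measurable01 R) hi).
  apply: filterS; first exact: (ae_filter_ringOfSetsType mu).
  by move=> x /= [] //; rewrite ltNyr.
have E (h : R -> R) x : integrable01 h ->
    \int[mu]_(t in `]-oo, x]) (h \_ I01) t =
    if x < 0 then 0 else prim h (Num.min x 1).
  move=> hi; rewrite -Rintegral_mkcondr; case: ltP => x0.
    rewrite (_ : _ `&` _ = set0) ?Rintegral_set0//.
    apply/seteqP; split => // t [] /=; rewrite !in_itv/= => tx /andP[t0 _].
    by have := le_lt_trans (le_trans t0 tx) x0; rewrite ltxx.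
  congr (Rintegral _ _ _); apply/seteqP; split => t /=; rewrite !in_itv/= le_min.
    by move=> [-> /andP[-> ->]].
  by move=> /andP[-> /andP[-> ->]].
have FG : (fun x => \int[mu]_(t in `]-oo, x]) (f \_ I01) t) =
          (fun x => \int[mu]_(t in `]-oo, x]) (g \_ I01) t).
  apply/funext => x; rewrite !E//; case: ltP => x0 //; apply: fg.
  by rewrite /= in_itv/= ge_min lexx orbT le_min x0 ler01.
have [Ff Fg] := (F f fi, F g gi); rewrite FG in Ff.
apply: (@filterS2 _ _ (ae_filter_ringOfSetsType mu) _ _ _ _ Ff Fg) => x /= -> + xI.
by rewrite !patchE mem_set.
Qed.

(** Comparing the increments from x to a nearby y, for which y and y + l are
both in [0,1]; the bound on l leaves room for such a y on one side of x. *)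
Lemma shifted_prim_inj f g x l : {within I01, continuous f} ->
  {within I01, continuous g} -> `|l| < 1 -> I01 x -> I01 (x + l) ->
  (forall y, I01 y -> I01 (y + l) ->
     prim f y - prim f x = prim g (y + l) - prim g (x + l)) ->
  f x = g (x + l).
Proof.
move=> cf cg l1 xI xlI fg.
have [//|/eqP fgx] := eqVneq (f x) (g (x + l)).
have e0 : 0 < `|f x - g (x + l)| / 3.
  by rewrite divr_gt0// normr_gt0 subr_eq0; apply/eqP.
have [d d0 hd] := prim_diff cf xI e0.
have [d' d'0 hd'] := prim_diff cg xlI e0.
pose m := Num.min (Num.min d d') (1 - `|l|) / 2.
have [m0 md md' ml] : [/\ 0 < m, m < d, m < d' & 2 * m <= 1 - `|l|].
  have h1 : Num.min (Num.min d d') (1 - `|l|) <= d by rewrite !ge_min lexx.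
  have h2 : Num.min (Num.min d d') (1 - `|l|) <= d'.
    by rewrite !ge_min lexx orbT.
  have h3 : Num.min (Num.min d d') (1 - `|l|) <= 1 - `|l|.
    by rewrite ge_min lexx orbT.
  have h4 : 0 < Num.min (Num.min d d') (1 - `|l|).
    by rewrite !lt_min d0 d'0 subr_gt0.
  by rewrite /m; move: h1 h2 h3 h4; clear; set k := Num.min _ _ => *; split; lra.
clearbody m.
have [y yI [ylI yx]] : exists2 y, I01 y & I01 (y + l) /\ `|y - x| = m.
  have [l2 l3] := (ler_norm l, ler_norm (- l)); rewrite normrN in l3.
  move: xI xlI; rewrite /= !in_itv/= => /andP[x0 x1] /andP[xl0 xl1].
  have [/andP[xh xlh]|xh] := boolP ((x + m <= 1) && (x + m + l <= 1)).
    exists (x + m).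
      by rewrite /= in_itv/=; clear - m0 x0 xh; apply/andP; split; lra.
    split; first by rewrite /= in_itv/=; clear - m0 xl0 xlh; apply/andP; split; lra.
    by rewrite addrAC subrr add0r gtr0_norm.
  exists (x - m).
    rewrite /= in_itv/=; move: xh; rewrite negb_and -!ltNge => /orP[] xh;
      by clear - m0 ml l2 l3 x0 x1 xl0 xl1 xh; apply/andP; split; lra.
  split.
    rewrite /= in_itv/=; move: xh; rewrite negb_and -!ltNge => /orP[] xh;
      by clear - m0 ml l2 l3 x0 x1 xl0 xl1 xh; apply/andP; split; lra.
  by rewrite addrAC subrr add0r normrN gtr0_norm.
have := hd y yI; have := hd' (y + l) ylI.
have -> : y + l - (x + l) = y - x by ring.
rewrite yx => /(_ md') h1 /(_ md) h2.
move: h1 h2; rewrite (fg y)//; set p := prim g _ - _ => h1 h2.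
have : `|(y - x) * (f x - g (x + l))| <= 2 * (`|f x - g (x + l)| / 3 * m).
  rewrite (_ : (y - x) * (f x - g (x + l)) =
    (p - (y - x) * g (x + l)) - (p - (y - x) * f x)); last by ring.
  by apply: (le_trans (ler_normB _ _)); clear - h1 h2; lra.
rewrite normrM yx; set q := `|f x - g (x + l)| in e0 *.
by clear - e0 m0; nra.
Qed.

Lemma prim_inj_cont f g : {within I01, continuous f} ->
  {within I01, continuous g} ->
  (forall x, I01 x -> prim f x = prim g x) -> forall x, I01 x -> f x = g x.
Proof.
move=> cf cg fg x xI; rewrite -[x in RHS]addr0.
apply: shifted_prim_inj => //; rewrite ?normr0 ?addr0//.
by move=> y yI _; rewrite !addr0 !fg.
Qed.

End Uniqueness.

(** * Right derivatives *)

Section RightDerivatives.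
Context {R : realType}.
Implicit Types (f g : R -> R) (x y a l : R).

(** A generator only gives access to forward difference quotients in time. *)
Definition rder f x l := h^-1 * (f (x + h) - f x) @[h --> 0^'+] --> l.

Definition lcont f x := f y @[y --> x^'-] --> f x.

Lemma rderP f x l : rder f x l <-> forall e, 0 < e -> exists2 d, 0 < d &
  forall h, 0 < h -> h < d -> `|f (x + h) - f x - h * l| <= e * h.
Proof.
have E h : 0 < h -> `|l - h^-1 * (f (x + h) - f x)| * h =
   `|f (x + h) - f x - h * l|.
  move=> h0; rewrite -[X in _ * X = _](gtr0_norm h0) -normrM -[RHS]normrN.
  by congr `|_|; field; rewrite gt_eqF.
split=> [/cvgrPdist_le fl e e0|H].
  have /(_ e e0)[d /= d0 h] := fl.
  exists d => // k k0 kd; rewrite -E// ler_pM2r//; apply: h => //=.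
  by rewrite sub0r normrN gtr0_norm.
apply/cvgrPdist_le => e e0; have [d d0 h] := H e e0.
exists d => // k /=; rewrite sub0r normrN => kd k0.
rewrite -(ler_pM2r k0) E//; apply: h => //.
by rewrite -[k]gtr0_norm.
Qed.

Lemma rder_eq f x l l' : rder f x l -> l = l' -> rder f x l'.
Proof. by move=> ? <-. Qed.

Lemma rder_uniq f x l l' : rder f x l -> rder f x l' -> l = l'.
Proof. by move=> h h'; apply: (cvg_unique _ h h'); exact: norm_hausdorff. Qed.

Lemma rder_cst a x : rder (cst a) x 0.
Proof.
apply: cvg_near_cst; apply: nearW => h.
by rewrite /cst subrr mulr0.
Qed.

Lemma rderD f g x l m : rder f x l -> rder g x m ->
  rder (fun t => f t + g t) x (l + m).
Proof.
move=> hf hg; rewrite /rder.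
rewrite (_ : (fun h => _) = (fun h => h^-1 * (f (x + h) - f x) +
   h^-1 * (g (x + h) - g x))); first exact: cvgD.
by apply/funext => h; ring.
Qed.

Lemma rderZ a f x l : rder f x l -> rder (fun t => a * f t) x (a * l).
Proof.
move=> hf; rewrite /rder.
rewrite (_ : (fun h => _) = (fun h => a * (h^-1 * (f (x + h) - f x)))).
  by apply: cvgM => //; exact: cvg_cst.
by apply/funext => h; ring.
Qed.

Lemma rder_rcont f x l : rder f x l -> f (x + h) @[h --> 0^'+] --> f x.
Proof.
move=> hf.
have id0 : (h : R) @[h --> 0^'+] --> (0 : R) by exact: cvg_at_right_filter.
have : f x + h * (h^-1 * (f (x + h) - f x)) @[h --> 0^'+] --> f x + 0 * l.
  by apply: cvgD; [exact: cvg_cst|exact: cvgM].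
rewrite mul0r addr0; apply: cvg_trans; apply: near_eq_cvg.
near=> h.
by rewrite mulrA mulfV ?mul1r; [ring|rewrite gt_eqF].
Unshelve. all: by end_near. Qed.

Lemma rderM f g x l m : rder f x l -> rder g x m ->
  rder (fun t => f t * g t) x (l * g x + f x * m).
Proof.
move=> hf hg; rewrite /rder.
rewrite (_ : (fun h => _) = (fun h => h^-1 * (f (x + h) - f x) * g x +
   f (x + h) * (h^-1 * (g (x + h) - g x)))).
  apply: cvgD; first by apply: cvgM => //; exact: cvg_cst.
  by apply: cvgM => //; exact: rder_rcont hf.
by apply/funext => h; ring.
Qed.

Lemma is_derive_rder f x l : is_derive x 1 f l -> rder f x l.
Proof.
move=> [df <-]; have : h^-1 *: (f (h *: (1 : R) + x) - f x) @[h --> 0^'] --> 'D_1 f x.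
  exact: df.
move/cvg_dnbhs_at_right => H; rewrite /rder.
have -> : (fun h => h^-1 * (f (x + h) - f x)) =
          (fun h => h^-1 *: (f (h *: 1 + x) - f x)).
  by apply/funext => h; rewrite [h%:A]mulr1 [h + x]addrC.
exact: H.
Qed.

Lemma is_derive_cont f x l : is_derive x 1 f l -> {for x, continuous f}.
Proof. by move=> [df _]; apply: differentiable_continuous; exact/derivable1_diffP. Qed.

Lemma lcontP f x : lcont f x <-> forall e, 0 < e -> exists2 d, 0 < d &
  forall y, x - d < y -> y < x -> `|f y - f x| < e.
Proof.
split=> [/cvgrPdist_lt fl e e0|H].
  have /(_ e e0)[d /= d0 h] := fl.
  exists d => // y dy yx; rewrite distrC; apply: h => //=.
  by rewrite gtr0_norm ?subr_gt0// ltrBlDr -ltrBlDl.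
apply/cvgrPdist_lt => e e0; have [d d0 h] := H e e0.
exists d => // y /= yd yx; rewrite distrC; apply: h => //.
by move: yd; rewrite gtr0_norm ?subr_gt0// ltrBlDr -ltrBlDl.
Qed.

Lemma continuous_lcont f x : {for x, continuous f} -> lcont f x.
Proof. exact: cvg_at_left_filter. Qed.

Lemma lcontD f g x : lcont f x -> lcont g x -> lcont (fun t => f t + g t) x.
Proof. exact: cvgD. Qed.

Lemma lcontM f g x : lcont f x -> lcont g x -> lcont (fun t => f t * g t) x.
Proof. exact: cvgM. Qed.

Lemma lcontZ a f x : lcont f x -> lcont (fun t => a * f t) x.
Proof. by apply: cvgM; exact: cvg_cst. Qed.

(** For each slope e > 0, the largest interval [a,s] on which
|f y - f a| <= e (y - a) is closed by left continuity at s, and can be prolonged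
by the right derivative at s unless s = b. *)
Lemma rder0_const f a b : a <= b ->
  (forall x, a < x <= b -> lcont f x) ->
  (forall x, a <= x < b -> rder f x 0) -> f b = f a.
Proof.
move=> ab lc rd.
suff H e : 0 < e -> `|f b - f a| <= e * (b - a).
  apply/eqP; rewrite -subr_eq0 -normr_le0; apply/ler_addgt0Pl => e e0.
  have e1 : 0 < e / (b - a + 1) by rewrite divr_gt0// ltr_wpDl// subr_ge0.
  rewrite addr0; apply: (le_trans (H _ e1)).
  rewrite -mulrA ler_piMr ?(ltW e0)//.
  have ba : 0 < b - a + 1 by rewrite ltr_wpDl// subr_ge0.
  by rewrite ler_pdivrMl// mulr1; lra.
move=> e0.
pose E := [set x | a <= x <= b /\ forall y, a <= y <= x -> `|f y - f a| <= e * (y - a)].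
have Ea : E a.
  split; first by rewrite lexx.
  by move=> y; rewrite -eq_le => /eqP <-; rewrite !subrr normr0 mulr0.
have supE : has_sup E.
  by split; [exists a|exists b => x [/andP[] //]].
set s := sup E.
have as_ : a <= s by apply: sup_upper_bound.
have sb : s <= b by apply: ge_sup => [|x [/andP[] //]]; exists a.
have Hlt y : a <= y -> y < s -> `|f y - f a| <= e * (y - a).
  move=> ay ys; have sy : 0 < s - y by rewrite subr_gt0.
  have [z Ez yz] := sup_adherent sy supE.
  rewrite -/s subKr in yz; case: Ez => _; apply.
  by rewrite ay ltW.
have Hs : `|f s - f a| <= e * (s - a).
  move: as_; rewrite le_eqVlt => /predU1P[<-|as_].
    by rewrite !subrr normr0 mulr0.
  apply/ler_addgt0Pl => k k0.
  have /lcontP/(_ k k0)[d d0 hd] : lcont f s by apply: lc; rewrite as_ sb.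
  pose y := Num.max a (s - d / 2).
  have ay : a <= y by rewrite le_max lexx.
  have ys : y < s by rewrite gt_max as_/=; lra.
  have dy : s - d < y by rewrite lt_max; apply/orP; right; lra.
  have h1 := Hlt y ay ys; have h2 := hd y dy ys.
  rewrite distrC in h2.
  have := ler_normD (f s - f y) (f y - f a); rewrite addrA subrK => h3.
  apply: (le_trans h3); apply: lerD; first exact: ltW.
  by apply: (le_trans h1); rewrite ler_pM2l//; lra.
have [sb'|] := ltP s b; last first.
  move=> bs; have <- : s = b by apply/eqP; rewrite eq_le sb bs.
  exact: Hs.
have /rderP/(_ e e0)[d d0 hd] : rder f s 0 by apply: rd; rewrite as_ sb'.
pose k := Num.min (d / 2) (b - s).
have k0 : 0 < k by rewrite lt_min; apply/andP; split; lra.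
have kd : k < d by rewrite gt_min; apply/orP; left; lra.
have kb : s + k <= b.
  have : k <= b - s by rewrite ge_min lexx orbT.
  by lra.
suff Esk : E (s + k).
  have : s + k <= s by apply: sup_upper_bound.
  by move=> h; exfalso; lra.
split; first by apply/andP; split => //; lra.
move=> y /andP[ay ysk]; have [ys|ys] := ltP y s; first exact: Hlt.
move: ys; rewrite le_eqVlt => /predU1P[<- //|ys].
have := hd (y - s); rewrite subr_gt0 => /(_ ys).
have -> : y - s < d by lra.
move=> /(_ isT); rewrite mulr0 subr0 [s + _]addrC subrK => h1.
have := ler_normD (f y - f s) (f s - f a); rewrite addrA subrK => h2.
apply: (le_trans h2); rewrite (_ : e * (y - a) = e * (y - s) + e * (s - a)).
  exact: lerD.
by ring.
Qed.

End RightDerivatives.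

(** * The complex exponential and its logarithm *)

Section ComplexExponential.
Context {R : realType}.
Implicit Types (z w : R[i]) (a b x : R) (s : bool).

(** Indexing the two coordinates by a boolean lets each statement on real
functions be applied to both of them at once. *)
Definition reim s z : R := if s then Re z else Im z.

Lemma reim_inj z w : (forall s, reim s z = reim s w) -> z = w.
Proof.
move=> h; apply/eqP; rewrite eq_complex.
by have := h true; have := h false => /= -> ->; rewrite !eqxx.
Qed.

Lemma cReM z w : Re (z * w) = Re z * Re w - Im z * Im w.
Proof. by case: z w => ? ? [? ?]. Qed.

Lemma cImM z w : Im (z * w) = Re z * Im w + Im z * Re w.
Proof. by case: z w => ? ? [? ?]. Qed.

Lemma reimD s z w : reim s (z + w) = reim s z + reim s w.
Proof. by case: z w s => ? ? [? ?] []. Qed.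

Lemma reimN s z : reim s (- z) = - reim s z.
Proof. by case: z s => ? ? []. Qed.

Lemma reimB s z w : reim s (z - w) = reim s z - reim s w.
Proof. by rewrite reimD reimN. Qed.

Lemma reimZ s a z : reim s (a%:C * z) = a * reim s z.
Proof. by case: s; rewrite /= ?cReM ?cImM /= mul0r ?subr0 ?addr0. Qed.

Lemma reim_sq_le s z : reim s z ^+ 2 <= sqmod z.
Proof. by case: s; rewrite /sqmod ?lerDl ?lerDr sqr_ge0. Qed.

Lemma cexp0 : cexp (0 : R[i]) = 1.
Proof.
by apply: reim_inj => -[]; rewrite /= expR0 ?cos0 ?sin0 ?mulr1 ?mulr0.
Qed.

Lemma cexpD z w : cexp (z + w) = cexp z * cexp w.
Proof.
have Er : Re (z + w) = Re z + Re w by exact: (reimD true).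
have Ei : Im (z + w) = Im z + Im w by exact: (reimD false).
apply: reim_inj => -[] /=; rewrite /= ?cReM ?cImM /= Er Ei expRD ?cosD ?sinD; ring.
Qed.

Lemma cexpN z : cexp (- z) * cexp z = 1.
Proof. by rewrite -cexpD addNr cexp0. Qed.

Lemma cexp_neq0 z : cexp z != 0.
Proof.
by apply: contra_eqN (cexpN z) => /eqP ->; rewrite mulr0 eq_sym oner_eq0.
Qed.

Lemma cos_sin_2pi_int (k : int) x :
  cos (x + 2 * pi * k%:~R) = cos x /\ sin (x + 2 * pi * k%:~R) = sin x.
Proof.
have H (n : nat) (y : R) : cos (y + 2 * pi * n%:R) = cos y /\
                     sin (y + 2 * pi * n%:R) = sin y.
  elim: n y => [|n IHn] y; first by rewrite mulr0 addr0.
  have -> : y + 2 * pi * n.+1%:R = (y + pi *+ 2) + 2 * pi * n%:R :> R.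
    by rewrite -natr1; ring.
  by have [-> ->] := IHn (y + pi *+ 2); rewrite cosD2pi sinD2pi.
case: k => n; first exact: H.
have -> : (Negz n)%:~R = - n.+1%:R :> R by rewrite NegzE mulrNz.
have := H n.+1 (x + 2 * pi * - n.+1%:R).
by rewrite -addrA -mulrDr addNr mulr0 addr0 => -[-> ->].
Qed.

(** The imaginary part is reduced to [0, 2 pi[, and then by parity to the
interval [0, pi] where the cosine is injective. *)
Lemma cexp_eq1 z : cexp z = 1 -> exists k : int, z = 0 +i* (2 * pi * k%:~R).
Proof.
case: z => a b; rewrite /cexp /= => -[e1 e2].
have ea : expR a != 0 by rewrite gt_eqF ?expR_gt0.
have s0 : sin b = 0 by move/eqP: e2; rewrite mulf_eq0 (negbTE ea) => /eqP.
have a0 : expR a ^+ 2 = 1.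
  have := cos2Dsin2 b; rewrite s0 expr0n/= addr0 => cb.
  by rewrite -[LHS]mulr1 -cb -exprMn e1 expr1n.
have {}a0 : a = 0.
  move/eqP : a0; rewrite sqrf_eq1 => /orP[/eqP|/eqP h]; last first.
    by have := expR_gt0 a; rewrite h oppr_gt0 ltr10.
  by rewrite -expR0 => /expR_inj.
move: e1; rewrite a0 expR0 mul1r => c1.
have p0 : 0 < 2 * pi :> R by rewrite mulr_gt0// pi_gt0.
pose k := Num.floor (b / (2 * pi)).
have [c2 s2] := cos_sin_2pi_int k (b - 2 * pi * k%:~R).
rewrite subrK in c2 s2.
have /andP[k1 k2] : k%:~R <= b / (2 * pi) < (k + 1)%:~R := floor_itv _.
exists k; congr (_ +i* _); set r := b - _ in c2 s2.
have r0 : 0 <= r by rewrite subr_ge0 mulrC -ler_pdivlMr.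
have r2 : r < 2 * pi.
  by rewrite ltrBlDr; move: k2; rewrite ltr_pdivrMr// intrD; lra.
suff : r = 0 by move/eqP; rewrite subr_eq0 => /eqP.
have [rp|rp] := leP r pi.
  apply: cos_inj; rewrite ?in_itv/= ?r0 ?rp ?lexx ?pi_ge0//.
  by rewrite cos0 -c2.
suff : 2 * pi - r = 0 by lra.
apply: cos_inj; rewrite ?in_itv/= ?lexx ?pi_ge0//.
  by apply/andP; split; lra.
have [+ _] := cos_sin_2pi_int 1 (- r).
by rewrite mulr1 addrC cosN => ->; rewrite cos0 -c2.
Qed.

Lemma cexp_inj z w : cexp z = cexp w ->
  exists k : int, z = w + (0 +i* (2 * pi * k%:~R)).
Proof.
move=> zw; have : cexp (z - w) = 1 by rewrite cexpD zw mulrC cexpN.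
by move=> /cexp_eq1[k kE]; exists k; rewrite -kE addrC subrK.
Qed.

Lemma cexp_2pi_int (k : int) : cexp (0 +i* (2 * pi * k%:~R) : R[i]) = 1.
Proof.
rewrite /cexp /=; have := cos_sin_2pi_int k 0; rewrite add0r => -[-> ->].
by rewrite expR0 cos0 sin0 !mul1r.
Qed.

Lemma log_mpi2K a : a != 0 -> cexp (log_mpi2 a%:C) = a%:C.
Proof.
move=> a0; rewrite /log_mpi2; case: xgetP => [w _ [] //|].
have pi0 := pi_gt0 R.
have [a_gt0|a_lt0|/eqP] := ltgtP 0 a; last by rewrite eq_sym (negbTE a0).
- move=> /(_ (ln a +i* 0)) []; split => /=; last by apply/andP; split; lra.
  by rewrite /cexp /= lnK ?posrE// cos0 sin0 mulr1 mulr0.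
- move=> /(_ (ln (- a) +i* pi)) []; split => /=; last by apply/andP; split; lra.
  rewrite /cexp /= lnK ?posrE ?oppr_gt0// cospi sinpi mulr0.
  by rewrite mulrN1 opprK.
Qed.

(** The product of y with exp (- mu (x - a)) has zero right derivative. *)
Lemma exp_of_rder (y : R -> R[i]) a b mu : a <= b ->
  (forall s x, a < x <= b -> lcont (fun t => reim s (y t)) x) ->
  (forall s x, a <= x < b -> rder (fun t => reim s (y t)) x (reim s (mu * y x))) ->
  y b = cexp (mu * (b - a)%:C) * y a.
Proof.
move=> ab lc rd.
pose p := Re mu; pose q := Im mu.
pose E x := expR (- p * (x - a)).
pose C x := cos (q * (x - a)); pose S x := sin (q * (x - a)).
have dl k x : is_derive x 1 (fun t => k * (t - a)) k.
  have -> : (fun t => k * (t - a)) = (fun t => k *: (id t - cst a t)) by [].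
  by apply: is_derive_eq; rewrite subr0 [_ *: _]mulr1.
have dE x : is_derive x 1 E (- p * E x).
  by rewrite mulrC; exact: is_derive1_comp (is_derive_expR _) (dl (- p) x).
have dC x : is_derive x 1 C (- q * S x).
  rewrite mulNr mulrC -mulNr.
  exact: is_derive1_comp (is_derive_cos _) (dl q x).
have dS x : is_derive x 1 S (q * C x).
  by rewrite mulrC; exact: is_derive1_comp (is_derive_sin _) (dl q x).
pose y1 x := reim true (y x); pose y2 x := reim false (y x).
have ly1 := lc true; have ly2 := lc false.
have dy1 := rd true; have dy2 := rd false.
have lE x : lcont E x by exact: continuous_lcont (is_derive_cont (dE x)).
have lC x : lcont C x by exact: continuous_lcont (is_derive_cont (dC x)).
have lS x : lcont S x by exact: continuous_lcont (is_derive_cont (dS x)).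
have lcontN f x : lcont f x -> lcont (fun t => - f t) x by exact: cvgN.
have rderN f x l : rder f x l -> rder (fun t => - f t) x (- l).
  move=> h; rewrite -mulN1r.
  rewrite (_ : (fun t => - f t) = (fun t => -1 * f t)); first exact: rderZ.
  by apply/funext => t; rewrite mulN1r.
have A : E b * (C b * y1 b + S b * y2 b) = E a * (C a * y1 a + S a * y2 a).
  apply: (rder0_const (f := fun x => E x * (C x * y1 x + S x * y2 x)) ab) => x xab.
    by apply: lcontM => //; apply: lcontD; apply: lcontM => //; auto.
  apply: rder_eq.
    apply: rderM; first exact: is_derive_rder.
    apply: rderD; apply: rderM; try exact: is_derive_rder; auto.
  by rewrite /y1 /y2 /= cReM cImM -/p -/q; ring.
have B : E b * (C b * y2 b - S b * y1 b) = E a * (C a * y2 a - S a * y1 a).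
  apply: (rder0_const (f := fun x => E x * (C x * y2 x - S x * y1 x)) ab) => x xab.
    apply: lcontM => //; apply: lcontD; last apply: lcontN; apply: lcontM => //; auto.
  apply: rder_eq.
    apply: rderM; first exact: is_derive_rder.
    apply: rderD; last apply: rderN; apply: rderM; try exact: is_derive_rder; auto.
  by rewrite /y1 /y2 /= cReM cImM -/p -/q; ring.
have [E0 C0 S0] : [/\ E a = 1, C a = 1 & S a = 0].
  by rewrite /E /C /S subrr !mulr0 expR0 cos0 sin0.
rewrite E0 C0 S0 !mul1r mul0r addr0 in A.
rewrite E0 C0 S0 !mul1r mul0r subr0 in B.
have EE : expR (p * (b - a)) * E b = 1.
  by rewrite /E -expRD mulNr subrr expR0.
have CS : C b ^+ 2 + S b ^+ 2 = 1 by exact: cos2Dsin2.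
have Rb : Re (mu * (b - a)%:C) = p * (b - a) by rewrite cReM /= mulr0 subr0.
have Ib : Im (mu * (b - a)%:C) = q * (b - a) by rewrite cImM /= mulr0 add0r.
apply: reim_inj => -[]; rewrite /= ?cReM ?cImM /= Rb Ib -/(C b) -/(S b).
  rewrite -[Re (y a)]/(y1 a) -[Im (y a)]/(y2 a) -A -B.
  transitivity ((expR (p * (b - a)) * E b) * ((C b ^+ 2 + S b ^+ 2) * y1 b)).
    by rewrite EE CS !mul1r.
  by ring.
rewrite -[Re (y a)]/(y1 a) -[Im (y a)]/(y2 a) -A -B.
transitivity ((expR (p * (b - a)) * E b) * ((C b ^+ 2 + S b ^+ 2) * y2 b)).
  by rewrite EE CS !mul1r.
by ring.
Qed.

End ComplexExponential.

(** * Complex Sobolev functions on [0,1] *)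

Section SobolevOnInterval.
Context {R : realType}.
Local Notation mu := (@lebesgue_measure R).
Local Notation I01 := (`[0, 1]%classic : set R).
Implicit Types (f g h u w : R -> R[i]) (a : R[i]) (x y : R) (s : bool).

Hint Resolve measurable01 : core.

Lemma sqmod_ge0 a : 0 <= sqmod a.
Proof. by rewrite addr_ge0// sqr_ge0. Qed.

Lemma sqmodM a b : sqmod (a * b) = sqmod a * sqmod b.
Proof. by rewrite /sqmod cReM cImM; ring. Qed.

Lemma sqmodD_le a b : sqmod (a + b) <= 2 * sqmod a + 2 * sqmod b.
Proof.
rewrite /sqmod; have := reimD true a b; have := reimD false a b => /= -> ->.
have := sqr_ge0 (Re a - Re b); have := sqr_ge0 (Im a - Im b); nra.
Qed.

Lemma sqmodC (r : R) : sqmod r%:C = r ^+ 2.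
Proof. by rewrite /sqmod /= expr0n addr0. Qed.

Lemma reimMt a b : reim true (a * b) = Re a * reim true b - Im a * reim false b.
Proof. exact: cReM. Qed.

Lemma reimMf a b : reim false (a * b) = Re a * reim false b + Im a * reim true b.
Proof. exact: cImM. Qed.

Lemma reim_primitive0 s g x :
  reim s (primitive0 g x) = prim (fun t => reim s (g t)) x.
Proof. by case: s. Qed.

Lemma L2_integrable_sqmod f : L2 f -> integrable01 (fun x => sqmod (f x)).
Proof.
move=> [mr mi fin]; apply/integrableP; split.
  by apply/measurable_EFinP; apply: measurable_funD; exact: measurable_funX.
apply: le_lt_trans fin; rewrite le_eqVlt; apply/orP; left; apply/eqP.
by apply: eq_integral => x _ /=; rewrite ger0_norm// sqmod_ge0.
Qed.

(** The integrability of the squared modulus splits into that of the squares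
of the two coordinates. *)
Lemma L2P f : L2 f <-> forall s, sqint (fun x => reim s (f x)).
Proof.
split=> [Lf|h].
  have fi := L2_integrable_sqmod Lf; case: Lf => mr mi _.
  have ms s : measurable_fun I01 (fun x => reim s (f x)).
    by case: s; [exact: mr|exact: mi].
  move=> s; split => //; apply: le_integrable fi => //.
    by apply/measurable_EFinP; apply: measurable_funX; exact: ms.
  move=> x _ /=; rewrite lee_fin ger0_norm ?sqr_ge0//.
  by rewrite ger0_norm ?sqmod_ge0// reim_sq_le.
have [mr ir] := h true; have [mi ii] := h false; split => //.
have /integrableP[_] := integrable01D ir ii.
apply: le_lt_trans; rewrite le_eqVlt; apply/orP; left; apply/eqP.
by apply: eq_integral => x _ /=; rewrite ger0_norm// sqmod_ge0.
Qed.

Lemma L2_integrable f : L2 f -> forall s, integrable01 (fun x => reim s (f x)).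
Proof. by move=> /L2P h s; exact: sqint_integrable. Qed.

Lemma L2_lin a f g : L2 f -> L2 g -> L2 (fun x => a * f x + g x).
Proof.
move=> /L2P hf /L2P hg; apply/L2P => -[] /=.
  rewrite (_ : (fun x => _) = (fun x => (Re a * reim true (f x) +
    - Im a * reim false (f x)) + reim true (g x))).
    by apply: sqintD => //; apply: sqintD; exact: sqintZ.
  by apply/funext => x; rewrite [LHS](reimD true) /= cReM mulNr.
rewrite (_ : (fun x => _) = (fun x => (Re a * reim false (f x) +
    Im a * reim true (f x)) + reim false (g x))).
  by apply: sqintD => //; apply: sqintD; exact: sqintZ.
by apply/funext => x; rewrite [LHS](reimD false) /= cImM.
Qed.

Lemma L2_cst a : L2 (fun=> a).
Proof.
apply/L2P => s; apply: cont01_sqint; apply: continuous_subspaceT.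
by move=> x; exact: cst_continuous.
Qed.

Lemma L2Z a f : L2 f -> L2 (fun x => a * f x).
Proof.
move=> hf; have := L2_lin a hf (L2_cst 0).
by congr L2; apply/funext => x; rewrite addr0.
Qed.

Lemma primitive0_lin a f g x : L2 f -> L2 g -> x <= 1 ->
  primitive0 (fun t => a * f t + g t) x = a * primitive0 f x + primitive0 g x.
Proof.
move=> /L2_integrable hf /L2_integrable hg x1; apply: reim_inj => -[].
  rewrite reim_primitive0 reimD reimMt !reim_primitive0 -mulNr -!primZ// -!primD//.
  all: try exact: integrable01Z.
  all: try by apply: integrable01D; exact: integrable01Z.
  by apply: eq_prim => // t _; rewrite reimD reimMt mulNr.
rewrite reim_primitive0 reimD reimMf !reim_primitive0 -!primZ// -!primD//.
all: try exact: integrable01Z.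
all: try by apply: integrable01D; exact: integrable01Z.
by apply: eq_prim => // t _; rewrite reimD reimMf.
Qed.

Lemma primitive0_0 x : x <= 1 -> primitive0 (fun=> 0 : R[i]) x = 0.
Proof.
move=> x1; apply: reim_inj => s; rewrite reim_primitive0.
have := @primZ _ 0 (cst 0) x (integrable01_cst 0) x1.
rewrite mul0r => E; transitivity (0 : R); last by case: s.
by rewrite -[RHS]E; apply: eq_prim => // t _; rewrite mul0r; case: s.
Qed.

Lemma primitive0_at0 (f : R -> R[i]) : primitive0 f 0 = 0.
Proof. by apply: reim_inj => s; rewrite reim_primitive0 prim0; case: s. Qed.

Lemma primitive0Z a f x : L2 f -> x <= 1 ->
  primitive0 (fun t => a * f t) x = a * primitive0 f x.
Proof.
move=> hf x1; have z : L2 (fun=> 0 : R[i]) := L2_cst 0.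
have := primitive0_lin a hf z x1.
by rewrite primitive0_0// addr0 => <-; congr primitive0; apply/funext => t; rewrite addr0.
Qed.

Lemma eq_primitive0 f g x : x <= 1 -> (forall t, I01 t -> f t = g t) ->
  primitive0 f x = primitive0 g x.
Proof.
move=> x1 fg; apply: reim_inj => s; rewrite !reim_primitive0.
by apply: eq_prim => // t tI; rewrite fg.
Qed.

Lemma primitive0_ae f g x : L2 f -> L2 g -> x <= 1 -> ae_eq mu I01 f g ->
  primitive0 f x = primitive0 g x.
Proof.
move=> hf hg x1 fg; apply: reim_inj => s; rewrite !reim_primitive0.
have xS : `[0, x]%classic `<=` I01 by apply: subset_itvl; rewrite bnd_simp.
have mf h : L2 h -> measurable_fun `[0, x] (EFin \o (fun t => reim s (h t))).
  move=> /L2P/(_ s)[mh _]; apply/measurable_EFinP; exact: measurable_funS mh.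
rewrite /prim /Rintegral; congr fine; apply: ae_eq_integral => //.
- exact: mf.
- exact: mf.
- by apply: filterS fg => t /= + tx => ->; [|exact: xS].
Qed.

Lemma L2sqE f : L2 f -> L2sq f = sqnorm (fun x => reim true (f x)) +
                   sqnorm (fun x => reim false (f x)).
Proof.
move=> /L2P h.
by rewrite /sqnorm -RintegralD//; case: (h true) (h false) => [? ?] [].
Qed.

Lemma sqmod_primitive0_le f x : L2 f -> I01 x -> sqmod (primitive0 f x) <= L2sq f.
Proof.
move=> hf; rewrite /= in_itv/= => xI; have := hf => /L2P h.
rewrite L2sqE//; apply: lerD; [exact: (prim_sq_le (h true) xI)|exact: (prim_sq_le (h false) xI)].
Qed.

Lemma L2sq_ge0 f : 0 <= L2sq f.
Proof. by apply: Rintegral_ge0 => x _; exact: sqmod_ge0. Qed.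

Lemma L2sqD_le f g : L2 f -> L2 g ->
  L2sq (fun x => f x + g x) <= 2 * L2sq f + 2 * L2sq g.
Proof.
move=> hf hg.
have hfg : L2 (fun x => f x + g x).
  by have := L2_lin 1 hf hg; congr L2; apply/funext => x; rewrite mul1r.
rewrite /L2sq -!RintegralZl//; try exact: L2_integrable_sqmod.
rewrite -RintegralD//; try by apply: integrable01Z; exact: L2_integrable_sqmod.
apply: le_Rintegral => //; first exact: L2_integrable_sqmod.
  by apply: integrable01D; apply: integrable01Z; exact: L2_integrable_sqmod.
by move=> x _; exact: sqmodD_le.
Qed.

Lemma L2sqZ a f : L2 f -> L2sq (fun x => a * f x) = sqmod a * L2sq f.
Proof.
move=> hf; rewrite /L2sq -RintegralZl//; last exact: L2_integrable_sqmod.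
by apply: eq_Rintegral => x _; exact: sqmodM.
Qed.

Lemma L2sq_ae f g : L2 f -> L2 g -> ae_eq mu I01 f g -> L2sq f = L2sq g.
Proof.
move=> hf hg fg; rewrite !L2sqE//; move: hf hg => /L2P hf /L2P hg.
by congr (_ + _); apply: sqnorm_ae => //; apply: filterS fg => x /= + Dx => ->.
Qed.

Lemma eq_L2sq f g : (forall x, I01 x -> f x = g x) -> L2sq f = L2sq g.
Proof. by move=> fg; apply: eq_Rintegral => x /set_mem xI; rewrite fg. Qed.

Lemma is_wderiv_lin a u u' g g' : is_wderiv u g -> is_wderiv u' g' ->
  is_wderiv (fun x => a * u x + u' x) (fun x => a * g x + g' x).
Proof.
move=> [hg hu] [hg' hu']; split; first exact: L2_lin.
move=> x xI; have x1 : x <= 1 by move: xI; rewrite /= in_itv/= => /andP[].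
by rewrite (hu x)// (hu' x)// primitive0_lin//; ring.
Qed.

Lemma is_wderivZ a u g : is_wderiv u g ->
  is_wderiv (fun x => a * u x) (fun x => a * g x).
Proof.
move=> [hg hu]; split; first exact: L2Z.
move=> x xI; have x1 : x <= 1 by move: xI; rewrite /= in_itv/= => /andP[].
by rewrite (hu x)// primitive0Z//; ring.
Qed.

Lemma is_wderivD u u' g g' : is_wderiv u g -> is_wderiv u' g' ->
  is_wderiv (fun x => u x + u' x) (fun x => g x + g' x).
Proof.
move=> h h'; have := is_wderiv_lin 1 h h'.
by congr is_wderiv; apply/funext => x; rewrite mul1r.
Qed.

Lemma is_wderiv_cst a : is_wderiv (fun=> a : R[i]) (fun=> 0).
Proof.
split; first exact: L2_cst.
move=> x; rewrite /= in_itv/= => /andP[_ x1].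
by rewrite primitive0_0// addr0.
Qed.

Lemma is_wderiv_primitive0 a f : L2 f ->
  is_wderiv (fun x => a + primitive0 f x) f.
Proof. by move=> hf; split => // x _; rewrite primitive0_at0 addr0. Qed.

Lemma I01_0 : I01 0. Proof. by rewrite /= in_itv/= lexx ler01. Qed.
Lemma I01_1 : I01 1. Proof. by rewrite /= in_itv/= lexx ler01. Qed.

Lemma is_wderiv_congr u w g : (forall x, I01 x -> u x = w x) ->
  is_wderiv u g -> is_wderiv w g.
Proof.
move=> uw [hg hu]; split => // x xI.
by rewrite -!uw//; [exact: hu|exact: I01_0].
Qed.

Lemma wderiv_congr u w : (forall x, I01 x -> u x = w x) -> wderiv u = wderiv w.
Proof.
move=> uw; rewrite /wderiv; congr xget; apply/seteqP; split => g;
  apply: is_wderiv_congr => // x xI; exact/esym/uw.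
Qed.

(** The derivative is chosen from a set that only sees the values on [0,1]. *)
Lemma cderiv_congr u w : (forall x, I01 x -> u x = w x) ->
  cderiv u = cderiv w.
Proof.
move=> uw; rewrite /cderiv; congr xget; apply/seteqP.
by split => g [h1 h2]; split => //; apply: is_wderiv_congr h1 => x xI;
  rewrite uw.
Qed.

Lemma is_wderiv_ae u g g' : is_wderiv u g -> is_wderiv u g' -> ae_eq mu I01 g g'.
Proof.
move=> [hg hu] [hg' hu'].
have E s : ae_eq mu I01 (fun x => reim s (g x)) (fun x => reim s (g' x)).
  apply: prim_inj_ae; try exact: L2_integrable.
  move=> x xI; rewrite -!reim_primitive0; congr reim.
  by apply: (addrI (u 0)); rewrite -hu// -hu'.
apply: (@filterS2 _ _ (ae_filter_ringOfSetsType mu) _ _ _ _ (E true) (E false)).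
by move=> x /= h1 h2 xI; apply: reim_inj => -[]; auto.
Qed.

Lemma wderivP u : H1 u -> is_wderiv u (wderiv u).
Proof. by move=> [g hg]; rewrite /wderiv; case: xgetP => [h _ //|/(_ g)]. Qed.

Lemma cderivP u : H2 u -> is_wderiv u (cderiv u) /\ H1 (cderiv u).
Proof. by move=> [g hg]; rewrite /cderiv; case: xgetP => [h _ //|/(_ g)]. Qed.

Lemma wderiv_ae u g : is_wderiv u g -> ae_eq mu I01 (wderiv u) g.
Proof.
by move=> hg; apply: (is_wderiv_ae _ hg); apply: wderivP; exists g.
Qed.

Lemma H1_cont u : H1 u -> forall s, {within I01, continuous (fun x => reim s (u x))}.
Proof.
move=> [g [hg hu]] s.
have E : {in I01, (fun x => reim s (u 0) +
   prim (fun t => reim s (g t)) x) =1 (fun x => reim s (u x))}.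
  by move=> x /set_mem xI; rewrite (hu x)// reimD reim_primitive0.
apply: (subspace_eq_continuous E) => x.
apply: continuousD; first exact: cst_continuous.
by apply: prim_cont01; exact: L2_integrable.
Qed.

Lemma H1_L2 u : H1 u -> L2 u.
Proof. by move=> hu; apply/L2P => s; apply: cont01_sqint; exact: H1_cont. Qed.

Lemma H1_lin a u w : H1 u -> H1 w -> H1 (fun x => a * u x + w x).
Proof.
by move=> [g hg] [h hh]; exists (fun x => a * g x + h x); exact: is_wderiv_lin.
Qed.

(** Bounding u x by u y and the integral of the derivative between y and x,
then integrating over y in [0,1]. *)
Lemma H1_sup_le u x : H1 u -> I01 x ->
  sqmod (u x) <= 2 * L2sq u + 8 * L2sq (wderiv u).
Proof.
move=> hu xI; have [hg uE] := wderivP hu; set g := wderiv u in hg uE *.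
have uL2 := H1_L2 hu.
have key y : I01 y -> sqmod (u x) <= 2 * sqmod (u y) + 8 * L2sq g.
  move=> yI.
  have -> : u x = u y + (primitive0 g x + (-1)%:C * primitive0 g y).
    by rewrite (uE x)// (uE y)// rmorphN rmorph1; ring.
  apply: (le_trans (sqmodD_le _ _)); rewrite lerD2l.
  have := sqmodD_le (primitive0 g x) ((-1)%:C * primitive0 g y).
  rewrite sqmodM sqmodC sqrrN expr1n mul1r.
  have := sqmod_primitive0_le hg xI; have := sqmod_primitive0_le hg yI; lra.
have i1 := L2_integrable_sqmod uL2.
have : prim (cst (sqmod (u x))) 1 <= prim (fun y => 2 * sqmod (u y) + 8 * L2sq g) 1.
  apply: le_Rintegral => //; first exact: (integrable01_cst (sqmod (u x))).
  apply: integrable01D; first exact: integrable01Z.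
  exact: (integrable01_cst (8 * L2sq g)).
have i2 := integrable01Z 2 i1.
have i3 := integrable01_cst (8 * L2sq g).
rewrite (primD i2 i3)// primZ// (prim_cst (8 * L2sq g))// prim_cst// !mulr1; apply.
Qed.

End SobolevOnInterval.

Arguments H1_cont {R u} _ s.

(** * Continuity points of right-continuous curves *)

Section ContinuityPoints.
Context {R : realType}.
Variable d : R -> R -> R.
Hypothesis dC : forall s t : R, 0 <= s -> 0 <= t -> d s t = d t s.
Hypothesis dtri : forall r s t : R, 0 <= r -> 0 <= s -> 0 <= t ->
  d s t <= 2 * (d s r + d r t).
Hypothesis dright : forall t e : R, 0 <= t -> 0 < e ->
  exists2 k : R, 0 < k & forall h : R, 0 < h -> h < k -> d (t + h) t < e.

(** The points around which the oscillation is less than 1/(n+1) form an open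
set; it is dense because the oscillation is small immediately to the right of
any point.  Baire's theorem provides a common point of these sets in ]a,b[.
The factor 2 in the triangle inequality is the one of the energy norm in
[normHD_le]. *)
Lemma right_continuous_has_continuity_point (a b : R) : 0 <= a -> a < b ->
  exists2 t, a < t < b & forall e, 0 < e ->
    exists2 k, 0 < k & forall s, 0 <= s -> `|s - t| < k -> d s t < e.
Proof.
move=> a0 ab.
pose O n : set R^o := [set t | exists2 k : R, 0 < k & forall s s' : R, 0 <= s -> 0 <= s' ->
  `|s - t| < k -> `|s' - t| < k -> d s s' < n.+1%:R^-1].
have OO n : open (O n) /\ dense (O n).
  split.
    rewrite openE => t [k k0 hk]; exists (k / 2) => /=; first by rewrite divr_gt0.
    move=> t' /= tt'; exists (k / 2); first by rewrite divr_gt0.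
    have near s : `|s - t'| < k / 2 -> `|s - t| < k.
      move=> st'; have := ler_distD t' s t; rewrite [X in _ <= _ + X]distrC => ?.
      by lra.
    by move=> s s' s0 s'0 /near h /near h'; exact: hk.
  move=> D [y Dy]; rewrite openE => /(_ y Dy)[r /= r0 Dr].
  have [y0|y0] := ltP y 0.
    exists y; split => //; exists (- y); first by rewrite oppr_gt0.
    by move=> s s' s0 _; have := ler_norm (s - y) => ? ? _; exfalso; lra.
  have n0 : 0 < n.+1%:R^-1 / 4 :> R by rewrite divr_gt0// invr_gt0.
  have [k k0 hk] := dright y0 n0.
  (* Right continuity at y controls the oscillation on ]y, y + k[. *)
  pose m := Num.min k r / 2.
  have [m0 mk mr] : [/\ 0 < m, 2 * m <= k & 2 * m <= r].
    have h1 : Num.min k r <= k by rewrite ge_min lexx.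
    have h2 : Num.min k r <= r by rewrite ge_min lexx orbT.
    have h3 : 0 < Num.min k r by rewrite lt_min k0.
    by rewrite /m; split; lra.
  clearbody m; exists (y + m); split.
    apply: Dr => /=; rewrite opprD addrA subrr add0r normrN gtr0_norm//.
    by lra.
  exists m => // s s' s0 s'0 sm s'm.
  have near x : `|x - (y + m)| < m -> d x y < n.+1%:R^-1 / 4.
    rewrite ltr_norml => /andP[h1 h2].
    have := hk (x - y); rewrite [y + _]addrC subrK; apply.
      lra.
    lra.
  have h1 := near s sm; have h2 := near s' s'm; rewrite (dC s'0 y0) in h2.
  by have := dtri y0 s0 s'0; move: h1 h2; set q := _^-1; lra.
have oab : open (`]a, b[%classic : set R^o) by apply: itv_open.
have := Baire OO; rewrite /dense => /(_ `]a, b[%classic).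
have ab0 : (`]a, b[%classic : set R) !=set0.
  by exists ((a + b) / 2); rewrite /= in_itv/=; apply/andP; split; lra.
move=> /(_ ab0 oab)[t [/= tab tO]].
rewrite in_itv/= in tab; exists t => // e e0.
have [n ne] : exists n, n.+1%:R^-1 < e.
  exists (Num.truncn e^-1); rewrite invf_plt ?posrE//.
  exact: truncnS_gt.
have [k k0 hk] := tO n I.
exists k => // s s0 sk; apply: lt_trans ne; apply: hk => //.
  by case/andP: tab => ta _; exact: le_trans (ltW ta).
by rewrite subrr normr0.
Qed.

End ContinuityPoints.

(** * The energy space *)

Section EnergySpace.
Context {R : realType} {N : nat}.
Local Notation mu := (@lebesgue_measure R).
Local Notation I01 := (`[0, 1]%classic : set R).
Variables (k1 : nat) (e1 e2 : 'I_N).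
Local Notation inH := (@inH R N k1 e1 e2).
Implicit Types (U W X : state R N) (a : R[i]) (x t h : R).

Definition regular U := forall i, H1 (U i).1 /\ L2 (U i).2.

Lemma inH_regular U : inH U -> regular U.
Proof. by case. Qed.

Lemma state_eq U W : (forall i x, (U i).1 x = (W i).1 x) ->
  (forall i x, (U i).2 x = (W i).2 x) -> U = W.
Proof.
move=> h1 h2; apply/funext => i; rewrite [U i]surjective_pairing [W i]surjective_pairing.
by congr pair; apply/funext => x; [exact: h1|exact: h2].
Qed.

Lemma stateD1 U W i x : ((U + W) i).1 x = (U i).1 x + (W i).1 x.
Proof. by []. Qed.

Lemma stateD2 U W i x : ((U + W) i).2 x = (U i).2 x + (W i).2 x.
Proof. by []. Qed.

Lemma stateN1 U i x : ((- U) i).1 x = - (U i).1 x. Proof. by []. Qed.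

Lemma stateN2 U i x : ((- U) i).2 x = - (U i).2 x. Proof. by []. Qed.

Lemma stateZ1 a U i x : (scaleH a U i).1 x = a * (U i).1 x. Proof. by []. Qed.

Lemma stateZ2 a U i x : (scaleH a U i).2 x = a * (U i).2 x. Proof. by []. Qed.

Definition stateE :=
  (stateD1, stateD2, stateN1, stateN2, stateZ1, stateZ2).

(** Linearity of a semigroup is available for this shape of combinations. *)
Lemma state_subE U W : U - W = scaleH (-1) W + U.
Proof. by apply: state_eq => i x; rewrite !stateE mulN1r addrC. Qed.

Lemma regular_lin a U W : regular U -> regular W -> regular (scaleH a U + W).
Proof.
move=> hU hW i; have [[? ?] [? ?]] := (hU i, hW i).
by split; [exact: H1_lin|exact: L2_lin].
Qed.

Lemma inH_lin a U W : inH U -> inH W -> inH (scaleH a U + W).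
Proof.
move=> [rU u1 u2] [rW w1 w2]; split.
- exact: regular_lin.
- by move=> i hi; congr (_ * _ + _); [exact: u1|exact: w1].
- by move=> i hi; congr (_ * _ + _); [exact: u2|exact: w2].
Qed.

Lemma inHB U W : inH U -> inH W -> inH (U - W).
Proof. by move=> hU hW; rewrite state_subE; exact: inH_lin. Qed.

Lemma scaleHE a U : scaleH a U = scaleH (a - 1) U + U.
Proof. by apply: state_eq => i x; rewrite !stateE mulrBl mul1r subrK. Qed.

Lemma inHZ a U : inH U -> inH (scaleH a U).
Proof. by move=> hU; rewrite scaleHE; exact: inH_lin. Qed.

(** The square of the norm of the energy space, which is a sum over the edges. *)
Definition energy U : R :=
  \sum_i (L2sq (U i).1 + L2sq (wderiv (U i).1) + L2sq (U i).2).

Lemma energy_ge0 U : 0 <= energy U.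
Proof. by apply: sumr_ge0 => i _; rewrite !addr_ge0// L2sq_ge0. Qed.

Lemma energy_edge_le U i :
  L2sq (U i).1 + L2sq (wderiv (U i).1) + L2sq (U i).2 <= energy U.
Proof.
rewrite /energy (bigD1 i)//= lerDl sumr_ge0// => j _.
by rewrite !addr_ge0// L2sq_ge0.
Qed.

Lemma H1_wderiv_L2 (u : R -> R[i]) : H1 u -> L2 (wderiv u).
Proof. by move=> /wderivP[]. Qed.

Lemma energyD_le U W : regular U -> regular W ->
  energy (U + W) <= 2 * energy U + 2 * energy W.
Proof.
move=> hU hW; rewrite /energy !mulr_sumr -big_split/=; apply: ler_sum => i _.
have [u1 u2] := hU i; have [w1 w2] := hW i.
have d1 := L2sqD_le (H1_L2 u1) (H1_L2 w1).
have d2 := L2sqD_le u2 w2.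
have d3 := L2sqD_le (H1_wderiv_L2 u1) (H1_wderiv_L2 w1).
have wd := is_wderivD (wderivP u1) (wderivP w1).
have -> : L2sq (wderiv ((U i).1 + (W i).1)) =
   L2sq (fun x => wderiv (U i).1 x + wderiv (W i).1 x).
  have H1D : H1 ((U i).1 + (W i).1) by eexists; exact: wd.
  apply: L2sq_ae; first exact: H1_wderiv_L2.
    by case: wd.
  exact: wderiv_ae.
rewrite -[L2sq ((U i).1 + (W i).1)]/(L2sq (fun x => (U i).1 x + (W i).1 x)).
rewrite -[L2sq ((U i).2 + (W i).2)]/(L2sq (fun x => (U i).2 x + (W i).2 x)).
by clear - d1 d2 d3; lra.
Qed.

Lemma energyZ a U : regular U -> energy (scaleH a U) = sqmod a * energy U.
Proof.
move=> hU; rewrite /energy mulr_sumr; apply: eq_bigr => i _ /=.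
have [u1 u2] := hU i; rewrite !mulrDr L2sqZ; last exact: H1_L2.
rewrite [X in _ + X = _]L2sqZ//; congr (_ + _ + _).
rewrite -L2sqZ; last exact: H1_wderiv_L2.
have wd := is_wderivZ a (wderivP u1).
apply: L2sq_ae; first by apply: H1_wderiv_L2; eexists; exact: wd.
  by case: wd.
exact: wderiv_ae.
Qed.

Lemma energy_eqH U W : regular U -> regular W -> eqH U W -> energy U = energy W.
Proof.
move=> hU hW UW; apply: eq_bigr => i _.
have [[u1 u2] [w1 w2]] := (hU i, hW i); have [UW1 UW2] := UW i.
by rewrite (eq_L2sq UW1) (wderiv_congr UW1) (L2sq_ae u2 w2).
Qed.

Lemma normH_energy U : normH U ^+ 2 = energy U.
Proof. by rewrite sqr_sqrtr// energy_ge0. Qed.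

Lemma normH_ge0 U : 0 <= normH U. Proof. exact: sqrtr_ge0. Qed.

(** The factor 2 replaces Minkowski's inequality by the pointwise inequality
|a + b|^2 <= 2 |a|^2 + 2 |b|^2. *)
Lemma normHD_le U W : regular U -> regular W ->
  normH (U + W) <= 2 * (normH U + normH W).
Proof.
move=> hU hW; have := energyD_le hU hW; rewrite -!normH_energy => h.
rewrite -ler_sqr ?nnegrE ?mulr_ge0 ?addr_ge0 ?normH_ge0//.
have := normH_ge0 U; have := normH_ge0 W; nra.
Qed.

Lemma normH_eqH U W : regular U -> regular W -> eqH U W -> normH U = normH W.
Proof. by move=> hU hW UW; rewrite /normH -!/(energy _) (energy_eqH hU hW UW). Qed.

Lemma normHZ_real (r : R) U : regular U -> normH (scaleH r%:C U) = `|r| * normH U.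
Proof.
move=> hU; apply/eqP; rewrite -(@eqrXn2 _ 2) ?mulr_ge0 ?normH_ge0//.
by rewrite exprMn !normH_energy energyZ// sqmodC real_normK// num_real.
Qed.

Lemma normH_subC U W : regular U -> regular W -> normH (U - W) = normH (W - U).
Proof.
move=> hU hW; rewrite -[LHS]mul1r -normr1 -normrN -normHZ_real; last first.
  by rewrite state_subE; exact: regular_lin.
by congr normH; apply: state_eq => i x; rewrite !stateE rmorphN rmorph1 mulN1r opprB.
Qed.

Lemma eqH_refl U : eqH U U.
Proof. by move=> i; split => //; exact: ae_eq_refl. Qed.

Lemma eqH_sym U W : eqH U W -> eqH W U.
Proof.
by move=> h i; have [h1 h2] := h i; split=> [x xI|]; [rewrite h1|exact: ae_eq_sym].
Qed.

Lemma eqH_trans W U X : eqH U W -> eqH W X -> eqH U X.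
Proof.
move=> h h' i; have [[h1 h2] [h3 h4]] := (h i, h' i); split=> [x xI|].
  by rewrite h1// h3.
exact: ae_eq_trans h2 h4.
Qed.

Lemma eqH_lin a U U' W W' : eqH U U' -> eqH W W' ->
  eqH (scaleH a U + W) (scaleH a U' + W').
Proof.
move=> h h' i; have [[h1 h2] [h3 h4]] := (h i, h' i); split=> [x xI|].
  by congr (_ * _ + _); [exact: h1|exact: h3].
apply: (@filterS2 _ _ (ae_filter_ringOfSetsType mu) _ _ _ _ h2 h4).
by move=> x /= H2 H4 xI; congr (_ * _ + _); auto.
Qed.

Lemma eqHB U U' W W' : eqH U U' -> eqH W W' -> eqH (U - W) (U' - W').
Proof. by move=> h h'; rewrite !state_subE; exact: eqH_lin. Qed.

(** The values of the u_i are bounded functionals on the energy space: this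
turns convergence in norm into pointwise information along orbits. *)
Lemma edge_sup_le U i x : regular U -> I01 x ->
  sqmod ((U i).1 x) <= 8 * energy U.
Proof.
move=> hU xI; have [u1 u2] := hU i; apply: (le_trans (H1_sup_le u1 xI)).
have := energy_edge_le U i; have := L2sq_ge0 (U i).1.
by have := L2sq_ge0 (U i).2; lra.
Qed.

Lemma edge_primitive_le U i x : regular U -> I01 x ->
  sqmod (primitive0 (U i).2 x) <= energy U.
Proof.
move=> hU xI; have [u1 u2] := hU i.
apply: (le_trans (sqmod_primitive0_le u2 xI)).
have := energy_edge_le U i; have := L2sq_ge0 (U i).1.
by have := L2sq_ge0 (wderiv (U i).1); lra.
Qed.

End EnergySpace.

(** * Orbits of a strongly continuous semigroup *)

Section Orbits.
Context {R : realType} {N : nat}.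
Local Notation I01 := (`[0, 1]%classic : set R).
Variables (k1 : nat) (e1 e2 : 'I_N).
Local Notation inH := (@inH R N k1 e1 e2).
Variable S : R -> state R N -> state R N.
Hypothesis HS : C0_semigroup k1 e1 e2 S.
Implicit Types (U W V : state R N) (a : R[i]) (x t h r s : R).

Let stable t U : 0 <= t -> inH U -> inH (S t U) := @sg_stable _ _ _ _ _ _ HS t U.

Let regS t U : 0 <= t -> inH U -> regular (S t U).
Proof. by move=> t0 hU; exact: inH_regular (stable t0 hU). Qed.

Lemma sg_scale t a U : 0 <= t -> inH U ->
  eqH (S t (scaleH a U)) (scaleH a (S t U)).
Proof.
by move=> t0 hU; rewrite !(scaleHE a); exact: (sg_linear HS).
Qed.

Lemma sg_sub t U W : 0 <= t -> inH U -> inH W ->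
  eqH (S t (U - W)) (S t U - S t W).
Proof. by move=> t0 hU hW; rewrite !state_subE; exact: (sg_linear HS). Qed.

Lemma sg_bounded_ge0 t : 0 <= t ->
  exists2 M, 0 <= M & forall U, inH U -> normH (S t U) <= M * normH U.
Proof.
move=> /(sg_bounded HS)[M hM]; exists `|M| => // U hU.
by apply: (le_trans (hM U hU)); rewrite ler_wpM2r ?normH_ge0// ler_norm.
Qed.

(** The difference of the orbit at times t + r and t + r' is the image by S t
of its difference at times r and r', with one bound for all r and r'. *)
Lemma orbit_shift_le t : 0 <= t -> exists2 M, 0 <= M & forall r r' U,
  0 <= r -> 0 <= r' -> inH U ->
  normH (S (t + r) U - S (t + r') U) <= M * normH (S r U - S r' U).
Proof.
move=> t0; have [M M0 hM] := sg_bounded_ge0 t0; exists M => // r r' U r0 r'0 hU.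
have [hr hr'] := (stable r0 hU, stable r'0 hU).
apply: le_trans (hM _ (inHB hr hr')).
rewrite le_eqVlt; apply/orP; left; apply/eqP.
have trH r0' : 0 <= r0' -> inH (S (t + r0') U) by move=> ?; apply: stable; rewrite ?addr_ge0.
apply: normH_eqH.
- by apply: inH_regular (inHB (trH _ r0) (trH _ r'0)).
- by apply: regS => //; exact: inHB.
apply: (eqH_trans (W := S t (S r U) - S t (S r' U))).
  by apply: eqHB; exact: (sg_add HS).
by apply: eqH_sym; exact: sg_sub.
Qed.

Lemma orbit_right_continuous t U e : 0 <= t -> inH U -> 0 < e ->
  exists2 k, 0 < k & forall h, 0 < h -> h < k -> normH (S (t + h) U - S t U) < e.
Proof.
move=> t0 hU e0; have [M M0 hM] := orbit_shift_le t0.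
have eM : 0 < e / (M + 1) by rewrite divr_gt0// ltr_wpDl.
have /cvgrPdist_lt/(_ _ eM)[k /= k0 hk] := sg_continuous HS hU.
exists k => // h h0 hk'.
have := hM h 0 U (ltW h0) (lexx 0) hU; rewrite addr0 => /le_lt_trans; apply.
have -> : normH (S h U - S 0 U) = normH (S h U - U).
  have hS := stable (ltW h0) hU.
  apply: normH_eqH.
  - by apply: inH_regular (inHB hS (stable (lexx 0) hU)).
  - exact: inH_regular (inHB hS hU).
  - by apply: eqHB; [exact: eqH_refl|exact: (sg_zero HS)].
have := hk h; rewrite /= sub0r normrN gtr0_norm// => /(_ hk' h0).
rewrite sub0r normrN ger0_norm ?normH_ge0// ltr_pdivlMr ?ltr_wpDl// => h1.
by apply: le_lt_trans h1; rewrite mulrC ler_wpM2l ?normH_ge0// lerDl.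
Qed.

(** The orbit has a continuity point t1 in ]0,t[, and S (t - t1) carries
continuity at t1 to continuity at t.  *)
Lemma orbit_continuous t U e : 0 < t -> inH U -> 0 < e ->
  exists2 k, 0 < k & forall s, 0 <= s -> `|s - t| < k ->
    normH (S s U - S t U) < e.
Proof.
move=> t0 hU e0.
pose d s s' := normH (S s U - S s' U).
have [t1 /andP[t10 t1t] ct1] : exists2 t1, 0 < t1 < t & forall e, 0 < e ->
    exists2 k, 0 < k & forall s, 0 <= s -> `|s - t1| < k -> d s t1 < e.
  apply: (right_continuous_has_continuity_point (d := d) _ _ _ (lexx 0) t0).
  - by move=> s s' s0 s'0; apply: normH_subC; exact: regS.
  - move=> r s s' r0 s0 s'0.
    have E : S s U - S s' U = (S s U - S r U) + (S r U - S s' U).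
      by apply: state_eq => i x; rewrite !stateE addrA subrK.
    rewrite /d E; apply: normHD_le; apply: inH_regular; apply: inHB; exact: stable.
  - by move=> s e' s0 e'0; exact: orbit_right_continuous.
have tt1 : 0 <= t - t1 by rewrite subr_ge0 ltW.
have [M M0 hM] := orbit_shift_le tt1.
have eM : 0 < e / (M + 1) by rewrite divr_gt0// ltr_wpDl.
have [k k0 hk] := ct1 _ eM.
exists (Num.min k t1); first by rewrite lt_min k0.
move=> s s0; rewrite lt_min => /andP[sk st1].
have r0 : 0 <= s - t + t1.
  by move: st1; rewrite ltr_norml => /andP[? _]; lra.
have := hM (s - t + t1) t1 U r0 (ltW t10) hU.
have -> : t - t1 + (s - t + t1) = s by ring.
rewrite subrK => /le_lt_trans; apply.
have := hk _ r0; rewrite addrK => /(_ sk).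
rewrite /d ltr_pdivlMr ?ltr_wpDl// => h1.
by apply: le_lt_trans h1; rewrite mulrC ler_wpM2l ?normH_ge0// lerDl.
Qed.

(** W is the value at V of the infinitesimal generator. *)
Definition has_velocity V W :=
  normH (scaleH (h^-1)%:C (S h V - V) - W) @[h --> 0^'+] --> 0.

Lemma has_velocity_at t V W e : 0 <= t -> inH V -> inH W -> has_velocity V W ->
  0 < e -> exists2 k, 0 < k & forall h, 0 < h -> h < k ->
    normH (scaleH (h^-1)%:C (S (t + h) V - S t V) - S t W) < e.
Proof.
move=> t0 hV hW vel e0; have [M M0 hM] := sg_bounded_ge0 t0.
have eM : 0 < e / (M + 1) by rewrite divr_gt0// ltr_wpDl.
have /cvgrPdist_lt/(_ _ eM)[k /= k0 hk] := vel.
exists k => // h h0 hk'.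
have hS := stable (ltW h0) hV.
have hX : inH (scaleH (h^-1)%:C (S h V - V) - W).
  by apply: inHB => //; apply: inHZ; exact: inHB.
have th0 : 0 <= t + h by rewrite addr_ge0// ltW.
have -> : normH (scaleH (h^-1)%:C (S (t + h) V - S t V) - S t W) =
    normH (S t (scaleH (h^-1)%:C (S h V - V) - W)).
  apply: normH_eqH.
  - apply: inH_regular; apply: inHB; last exact: stable.
    by apply: inHZ; apply: inHB; exact: stable.
  - by apply: inH_regular; exact: stable.
  apply: eqH_sym; apply: (eqH_trans (sg_sub _ _ _)) => //.
    by apply: inHZ; exact: inHB.
  apply: eqHB; last exact: eqH_refl.
  apply: (eqH_trans (sg_scale _ _ _)) => //; first exact: inHB.
  rewrite [X in eqH X _]scaleHE [X in eqH _ X]scaleHE.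
  have E : eqH (S t (S h V - V)) (S (t + h) V - S t V).
    apply: (eqH_trans (sg_sub _ _ _)) => //.
    apply: eqHB; last exact: eqH_refl.
    by apply: eqH_sym; apply: (sg_add HS) => //; exact: ltW.
  exact: eqH_lin.
apply: (le_lt_trans (hM _ hX)).
have := hk h; rewrite /= sub0r normrN gtr0_norm// => /(_ hk' h0).
rewrite sub0r normrN ger0_norm ?normH_ge0// ltr_pdivlMr ?ltr_wpDl// => h1.
by apply: le_lt_trans h1; rewrite mulrC ler_wpM2l ?normH_ge0// lerDl.
Qed.

Section MovingFunctional.
Variables (F : R -> state R N -> R) (K : R).
Hypothesis K0 : 0 <= K.
Hypothesis Flin : forall x (r : R) U W, I01 x -> regular U -> regular W ->
  F x (scaleH r%:C U + W) = r * F x U + F x W.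
Hypothesis Fbound : forall x U, I01 x -> regular U -> `|F x U| <= K * normH U.

Let FB x U W : I01 x -> regular U -> regular W -> F x (U - W) = F x U - F x W.
Proof.
move=> xI hU hW; rewrite state_subE.
have -> : (-1 : R[i]) = (-1 : R)%:C by rewrite rmorphN rmorph1.
by rewrite Flin// mulN1r addrC.
Qed.

Let regB U W : regular U -> regular W -> regular (U - W).
Proof. by move=> hU hW; rewrite state_subE; exact: regular_lin. Qed.

Let regZ a U : regular U -> regular (scaleH a U).
Proof. by move=> hU; rewrite scaleHE; exact: regular_lin. Qed.

Let FZ x r U : I01 x -> regular U -> F x (scaleH r%:C U) = r * F x U.
Proof.
move=> xI hU; have -> : scaleH r%:C U = scaleH (r - 1)%:C U + U.
  by rewrite rmorphB rmorph1 -scaleHE.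
by rewrite Flin// mulrBl mul1r subrK.
Qed.

(** The functional F x is evaluated at a point x s that moves with time; the
bound K is uniform in x, so that the motion of the point and that of the orbit
can be separated. *)
Lemma moving_lcont t U (x : R -> R) : 0 < t -> inH U ->
  (exists2 k, 0 < k & forall s, t - k < s -> s <= t -> I01 (x s)) ->
  lcont (fun s => F (x s) (S t U)) t -> lcont (fun s => F (x s) (S s U)) t.
Proof.
move=> t0 hU [k k0 xI] /lcontP lc; apply/lcontP => e e0.
have eh : 0 < e / 2 by rewrite divr_gt0.
have [k2 k20 h2] := lc _ eh.
have eM : 0 < e / 2 / (K + 1) by rewrite divr_gt0 ?divr_gt0// ltr_wpDl.
have [k3 k30 h3] := orbit_continuous t0 hU eM.
pose m := Num.min (Num.min k k2) (Num.min k3 t).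
have [m0 mk mk2 mk3 mt] : [/\ 0 < m, m <= k, m <= k2, m <= k3 & m <= t].
  by rewrite /m !lt_min !ge_min !lexx !orbT k0 k20 k30 t0.
clearbody m; exists m => // s ms st.
have s0 : 0 <= s by lra.
have xsI : I01 (x s) by apply: xI; lra.
have := h2 s; rewrite (_ : t - k2 < s); last by lra.
move=> /(_ isT st) h2s.
have := h3 s s0; rewrite ltr0_norm ?subr_lt0// (_ : - (s - t) < k3); last by lra.
move=> /(_ isT) h3s.
have -> : F (x s) (S s U) - F (x t) (S t U) =
   F (x s) (S s U - S t U) + (F (x s) (S t U) - F (x t) (S t U)).
  rewrite FB//; [by ring|exact: regS|by apply: regS => //; exact: ltW].
apply: (le_lt_trans (ler_normD _ _)).
have : `|F (x s) (S s U - S t U)| <= e / 2.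
  apply: (le_trans (Fbound xsI _)).
    by apply: regB; [exact: regS|by apply: regS => //; exact: ltW].
  move: h3s; rewrite ltr_pdivlMr ?ltr_wpDl// => /ltW; apply: le_trans.
  by rewrite mulrC ler_wpM2l ?normH_ge0// lerDl.
by lra.
Qed.

(** Chain rule: the velocity of the orbit and the motion of the point
contribute additively. *)
Lemma moving_rder t U W (x : R -> R) m : 0 <= t -> inH U -> inH W ->
  has_velocity U W ->
  (exists2 k, 0 < k & forall s, t <= s -> s < t + k -> I01 (x s)) ->
  F (x (t + h)) (S t W) @[h --> 0^'+] --> F (x t) (S t W) ->
  rder (fun s => F (x s) (S t U)) t m ->
  rder (fun s => F (x s) (S s U)) t (F (x t) (S t W) + m).
Proof.
move=> t0 hU hW vel [k k0 xI] cW rd.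
have rest : h^-1 * (F (x (t + h)) (S (t + h) U) - F (x (t + h)) (S t U)) -
    F (x (t + h)) (S t W) @[h --> 0^'+] --> 0.
  apply/cvgrPdist_le => e e0.
  have eM : 0 < e / (K + 1) by rewrite divr_gt0// ltr_wpDl.
  have [k2 k20 h2] := has_velocity_at t0 hU hW vel eM.
  exists (Num.min k k2) => /=; first by rewrite lt_min k0.
  move=> h /=; rewrite sub0r normrN lt_min => /andP[hk hk2] h0.
  rewrite gtr0_norm// in hk hk2.
  have xsI : I01 (x (t + h)) by apply: xI; lra.
  have th0 : 0 <= t + h by lra.
  have [rU rthU rW] : [/\ regular (S t U), regular (S (t + h) U) & regular (S t W)].
    by split; exact: regS.
  rewrite -FB// -FZ//; last exact: regB.
  rewrite -FB//; last by apply: regZ; exact: regB.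
  rewrite sub0r normrN; apply: (le_trans (Fbound xsI _)).
    by apply: regB => //; apply: regZ; exact: regB.
  have := h2 h h0 hk2; rewrite ltr_pdivlMr ?ltr_wpDl// => /ltW; apply: le_trans.
  by rewrite mulrC ler_wpM2l ?normH_ge0// lerDl.
rewrite /rder -[F _ _ + m]add0r addrA.
apply: cvg_trans (cvgD (cvgD rest cW) rd).
by apply: near_eq_cvg; near=> h; rewrite /= !fctE; ring.
Unshelve. all: by end_near. Qed.

End MovingFunctional.

End Orbits.

(** * Riemann invariants of eigenvectors *)

Section EdgeAnalysis.
Context {R : realType}.
Local Notation mu := (@lebesgue_measure R).
Local Notation I01 := (`[0, 1]%classic : set R).
Implicit Types (u v g h y : R -> R[i]) (f : R -> R) (x t r : R) (m lambda : R[i]).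

Lemma prim_rder f x : {within I01, continuous f} -> 0 <= x < 1 ->
  rder (prim f) x (f x).
Proof.
move=> cf /andP[x0 x1]; apply/rderP => e e0.
have xI : I01 x by rewrite /= in_itv/= x0 ltW.
have [d d0 hd] := prim_diff cf xI e0.
exists (Num.min d (1 - x)); first by rewrite lt_min d0 subr_gt0.
move=> h h0; rewrite lt_min => /andP[hd' h1].
have := hd (x + h); rewrite [x + h]addrC addrK gtr0_norm// addrC; apply => //.
by rewrite /= in_itv/=; apply/andP; split; lra.
Qed.

Lemma cont01_lcont f x : {within I01, continuous f} -> 0 < x <= 1 -> lcont f x.
Proof.
move=> cf /andP[x0 x1]; apply/lcontP => e e0.
have xI : I01 x by rewrite /= in_itv/= x1 ltW.
have [d d0 hd] := cont01P cf xI e0.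
exists (Num.min d x); first by rewrite lt_min d0.
move=> y yd yx; have h1 : Num.min d x <= x by rewrite ge_min lexx orbT.
have h2 : Num.min d x <= d by rewrite ge_min lexx.
apply: hd; first by rewrite /= in_itv/=; apply/andP; split; lra.
by rewrite ltr0_norm ?subr_lt0//; lra.
Qed.

(** The integral equation y = y(0) + m * (primitive of y) makes y
differentiable from the right with derivative m y. *)
Lemma volterra_exp y m : H1 y ->
  (forall x, I01 x -> y x = y 0 + primitive0 (fun t => m * y t) x) ->
  forall x, I01 x -> y x = cexp (m * x%:C) * y 0.
Proof.
move=> hy yE x; rewrite /= in_itv/= => /andP[x0 x1].
have hmy : H1 (fun t => m * y t).
  by case: hy => g hg; exists (fun t => m * g t); exact: is_wderivZ.
rewrite -[x in x%:C]subr0; apply: exp_of_rder => // s t /andP[t0 t1].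
  by apply: cont01_lcont; [exact: H1_cont|rewrite t0 (le_trans t1)].
have tt1 : 0 <= t < 1 by rewrite t0 (lt_le_trans t1).
have /rderP H := prim_rder (H1_cont hmy s) tt1.
apply/rderP => e e0; have [d d0 hd] := H e e0.
exists (Num.min d (1 - t)); first by rewrite lt_min d0 subr_gt0; case/andP: tt1.
move=> h h0; rewrite lt_min => /andP[hd' h1].
have tI : I01 t by rewrite /= in_itv/= t0 ltW//; case/andP: tt1.
have thI : I01 (t + h) by rewrite /= in_itv/=; apply/andP; split; lra.
have E z : I01 z -> reim s (y z) = reim s (y 0) + prim (fun t => reim s (m * y t)) z.
  by move=> zI; rewrite (yE z zI) reimD reim_primitive0.
rewrite (E _ thI) (E _ tI); have := hd h h0 hd'.
by congr (`| _ | <= _); ring.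
Qed.

(** Identifies the chosen derivatives of a function whose derivatives are
known explicitly. *)
Lemma cderiv_unique u g h : is_wderiv u g -> is_wderiv g h ->
  [/\ H2 u, forall x, I01 x -> cderiv u x = g x &
      ae_eq mu I01 (wderiv (cderiv u)) h].
Proof.
move=> ug gh; have hg : H1 g by exists h.
have hu : H2 u by exists g.
have [uc hc] := cderivP hu.
have E x : I01 x -> cderiv u x = g x.
  move=> xI; apply: reim_inj => s.
  apply: (prim_inj_cont (H1_cont hc s) (H1_cont hg s)) => // t tI.
  rewrite -!reim_primitive0; congr reim; apply: (addrI (u 0)).
  by rewrite -(proj2 uc)// -(proj2 ug).
split => //; rewrite (wderiv_congr E); exact: wderiv_ae.
Qed.

(** With v = lambda u and r^2 u'' = lambda v, the derivative of r u' + v is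
(lambda / r) (r u' + v). *)
Lemma eigen_riemann u v r lambda : r != 0 -> H2 u -> H1 v ->
  (forall x, I01 x -> v x = lambda * u x) ->
  ae_eq mu I01 (fun x => (r ^+ 2)%:C * wderiv (cderiv u) x)
               (fun x => lambda * v x) ->
  forall x, I01 x -> r%:C * cderiv u x + v x =
    cexp (lambda / r%:C * x%:C) * (r%:C * cderiv u 0 + v 0).
Proof.
move=> r0 hu hv vE Eg x xI.
have [ug hg] := cderivP hu; set g := cderiv u in ug hg Eg *.
have gh := wderivP hg; have vk := wderivP hv.
have vg : ae_eq mu I01 (wderiv v) (fun x => lambda * g x).
  apply: wderiv_ae; apply: is_wderiv_congr (is_wderivZ lambda ug).
  by move=> t tI; rewrite vE.
pose y t := r%:C * g t + v t.
have yw := is_wderiv_lin r%:C gh vk.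
have hy : H1 y by eexists; exact: yw.
apply: (@volterra_exp y) => // t tI.
have t1 : t <= 1 by move: tI; rewrite /= in_itv/= => /andP[].
rewrite [LHS](proj2 yw t tI); congr (_ + _); apply: primitive0_ae => //.
- by case: yw.
- by apply: L2Z; exact: H1_L2.
have rC0 : r%:C != 0 :> R[i] by apply: contra_neq r0 => /complexI.
apply: (@filterS2 _ _ (ae_filter_ringOfSetsType mu) _ _ _ _ vg Eg).
move=> s /= E1 E2 sI; rewrite E1// /y mulrDr.
have -> : r%:C * wderiv g s = lambda / r%:C * v s.
  apply: (mulfI rC0); rewrite mulrA -rmorphM -expr2 E2//.
  by rewrite mulrA mulrCA divff// mulr1.
by rewrite mulrA divfK// addrC.
Qed.

End EdgeAnalysis.

Section OrdinalSums.
Context {R : realType}.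

Lemma sum_ord_range_const (N m n : nat) (x : R[i]) (P : pred 'I_N) :
  (n <= N)%N -> (forall i : 'I_N, P i = (m <= i < n)%N) ->
  \sum_(i | P i) x = (n - m)%:R * x.
Proof.
move=> nN PE; rewrite (eq_bigl _ _ PE).
rewrite -(big_mkord (fun i => m <= i < n)%N (fun=> x)).
transitivity (\sum_(m <= i < n) x); last by rewrite sumr_const_nat mulr_natl.
by rewrite (big_nat_widenl m 0)// (big_nat_widen 0 n N).
Qed.

End OrdinalSums.

(** * Node conditions and the characteristic equation *)

Section TreeDomain.
Context {R : realType}.
Variables (N k1 k2 : nat).
Hypotheses (hk1 : (2 <= k1)%N) (hk2 : (2 <= k2)%N) (hN : (k1 + k2 = N + 1)%N).
Variables (e1 e2 : 'I_N).
Hypotheses (he1 : label e1 = 1%N) (he2 : label e2 = 2%N).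
Variable c : 'I_N -> R.
Hypothesis hc : forall i, 0 < c i.
Variables (alpha1 alpha2 : R).
Local Notation mu := (@lebesgue_measure R).
Local Notation I01 := (`[0, 1]%classic : set R).
Local Notation domA := (domAT k1 e1 e2 c alpha1 alpha2).
Local Notation out1 := (@out1 N k1).
Local Notation out2 := (@out2 N k1).
Implicit Types (U W : state R N) (x : R) (i : 'I_N) (lambda : R[i]).

Variant edge_spec i : Prop :=
| RootEdge of i = e1
| MiddleEdge of i = e2
| Leaf1 of (3 <= label i <= N)%N & out1 i & i != e2
| Leaf2 of (3 <= label i <= N)%N & out2 i.

Lemma edgeP i : edge_spec i.
Proof.
have iN : (i < N)%N := ltn_ord i.
have [li|li] := eqVneq (label i) 1%N.
  by apply: RootEdge; apply: val_inj; move: li he1; rewrite /label /=; lia.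
have [li2|li2] := eqVneq (label i) 2%N.
  by apply: MiddleEdge; apply: val_inj; move: li2 he2; rewrite /label /=; lia.
have l3 : (3 <= label i <= N)%N by move: li li2; rewrite /label; lia.
have [ik|ik] := leqP (label i) k1.
  apply: Leaf1 => //; first by rewrite /Defs.out1; lia.
  by apply: contra_neq li2 => ->.
by apply: Leaf2 => //; rewrite /Defs.out2; lia.
Qed.

Lemma out1_middle : out1 e2. Proof. by rewrite /Defs.out1 he2 hk1. Qed.

(** Node 1 is the origin of the middle edge and of k1 - 2 leaves. *)
Lemma sum_out1 (F : 'I_N -> R[i]) (p : R[i]) :
  (forall i, (3 <= label i <= N)%N -> out1 i -> F i = p) ->
  \sum_(i | out1 i) F i = F e2 + (k1 - 2)%:R * p.
Proof.
move=> Fp; rewrite (bigD1 e2) ?out1_middle//=; congr (_ + _).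
have E i : out1 i && (i != e2) = (2 <= i < k1)%N.
  have -> : (i != e2) = (label i != 2%N).
    by rewrite -he2 /label eqSS (inj_eq val_inj).
  by rewrite /Defs.out1 /label; lia.
rewrite (eq_bigr (fun=> p)); last first.
  move=> i hi; apply: Fp; last by case/andP: hi.
  by have iN : (i < N)%N := ltn_ord i; move: hi; rewrite E /label; lia.
by apply: sum_ord_range_const => //; lia.
Qed.

(** Node 2 is the origin of k2 - 1 leaves. *)
Lemma sum_out2 (F : 'I_N -> R[i]) (p : R[i]) :
  (forall i, (3 <= label i <= N)%N -> out2 i -> F i = p) ->
  \sum_(i | out2 i) F i = (k2 - 1)%:R * p.
Proof.
move=> Fp; have E i : out2 i = (k1 <= i < N)%N.
  by have iN : (i < N)%N := ltn_ord i; rewrite /Defs.out2 /label; lia.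
rewrite (eq_bigr (fun=> p)); last first.
  move=> i hi; apply: Fp => //.
  by have iN : (i < N)%N := ltn_ord i; move: hi; rewrite E /label; lia.
rewrite (sum_ord_range_const (m := k1) (n := N))//.
by congr (_ %:R * _); lia.
Qed.

Section DomainFacts.
Variable U : state R N.
Hypothesis dU : domA U.
Local Notation g i := (cderiv (U i).1).
Local Notation v i := ((U i).2).

Lemma dom_H2 i : H2 (U i).1. Proof. by case: dU => /(_ i)[]. Qed.
Lemma dom_H1 i : H1 (U i).2. Proof. by case: dU => /(_ i)[]. Qed.

Lemma dom_cderiv_H1 i : H1 (g i).
Proof. by case: (cderivP (dom_H2 i)). Qed.

Lemma dom_root : (c e1)%:C * g e1 0 = v e1 0.
Proof. by case: dU => _ [[]]. Qed.

Lemma dom_leaf i : (3 <= label i <= N)%N -> (c i)%:C * g i 1 = - v i 1.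
Proof. by case: dU => _ [[_ +]] _ _ _ => /(_ i). Qed.

Lemma dom_velocity1 i : out1 i -> v i 0 = v e1 1.
Proof. by case: dU => _ [_ [/(_ i) h _]] /h[]. Qed.

Lemma dom_velocity2 i : out2 i -> v i 0 = v e2 1.
Proof. by case: dU => _ [_ [_ /(_ i) h]] /h[]. Qed.

(** The modified Kirchhoff law at node 1 when the root edge and the leaves
only carry waves that leave the node. *)
Lemma node1_middle_slope : (c e1)%:C * g e1 1 = v e1 1 ->
  (forall i, (3 <= label i <= N)%N -> out1 i -> (c i)%:C * g i 0 = - v i 0) ->
  (c e2)%:C * g e2 0 = (k1%:R - 1 - alpha1)%:C * v e2 0.
Proof.
move=> h1 hleaf; case: dU => _ [[_ _ + _] _]; rewrite -/(g e1) -/(v e1) h1.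
rewrite (@sum_out1 _ (- v e1 1)); last first.
  by move=> i i3 io; rewrite -/(g i) hleaf// dom_velocity1.
rewrite -/(g e2) (dom_velocity1 out1_middle) natrB// !rmorphB !rmorph1 rmorph_nat.
move=> h; apply/eqP; rewrite -subr_eq0; move/eqP: h; rewrite -subr_eq0.
by congr (_ == _); ring.
Qed.

(** The modified Kirchhoff law at node 2 when the leaves only carry waves that
leave the node. *)
Lemma node2_middle_slope :
  (forall i, (3 <= label i <= N)%N -> out2 i -> (c i)%:C * g i 0 = - v i 0) ->
  (c e2)%:C * g e2 1 = (alpha2 - k2%:R + 1)%:C * v e2 1.
Proof.
move=> hleaf; case: dU => _ [[_ _ _ +] _]; rewrite -/(g e2) -/(v e2).
rewrite (@sum_out2 _ (- v e2 1)); last first.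
  by move=> i i3 io; rewrite -/(g i) hleaf// dom_velocity2.
rewrite natrB ?(ltnW hk2)// rmorphD rmorphB rmorph1 rmorph_nat.
move=> h; apply/eqP; rewrite -subr_eq0; move/eqP: h; rewrite -subr_eq0 -oppr_eq0.
by congr (_ == _); ring.
Qed.

End DomainFacts.

Section Eigenvalues.
Hypotheses (ha1 : alpha1 <> k1%:R) (ha2 : alpha2 <> k2%:R).

(** The external conditions annihilate the incoming invariants of the root edge
and of the leaves.  The two invariants P and M of the middle edge are tied at
both nodes; if one of them vanishes then so does the other, and then the whole
eigenvector.  Otherwise the two relations multiply to the stated equation. *)
Lemma nonzero_eigenvalue_equation lambda : lambda != 0 ->
  is_eigenvalue k1 e1 e2 c alpha1 alpha2 lambda ->
  [/\ alpha1 <> k1%:R - 2, alpha2 <> k2%:R - 2 &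
      cexp (2 * lambda / (c e2)%:C) =
      (((2 + alpha1 - k1%:R) * (2 + alpha2 - k2%:R)) /
       ((alpha1 - k1%:R) * (alpha2 - k2%:R)))%:C].
Proof.
move=> l0 [U [dU Unz AU]].
pose g i := cderiv (U i).1; pose v i := (U i).2.
have vE i x : I01 x -> v i x = lambda * (U i).1 x.
  by move=> xI; have [h _] := AU i; exact: h.
have riem i (r : R) : r != 0 -> r ^+ 2 = c i ^+ 2 -> forall x, I01 x ->
    r%:C * g i x + v i x =
    cexp (lambda / r%:C * x%:C) * (r%:C * g i 0 + v i 0).
  move=> r0 rc; apply: eigen_riemann => //; [exact: dom_H2|exact: dom_H1| |].
    exact: vE.
  by rewrite rc; have [_ h] := AU i.
have c0 i : c i != 0 by rewrite gt_eqF.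
have plus i x := @riem i (c i) (c0 i) erefl x.
have minus i x : I01 x -> (- c i)%:C * g i x + v i x =
    cexp (lambda / (- c i)%:C * x%:C) * ((- c i)%:C * g i 0 + v i 0).
  by apply: riem; [rewrite oppr_eq0|exact: sqrrN].
have NC i : (- c i)%:C = - (c i)%:C :> R[i] by rewrite rmorphN.
have root x : I01 x -> (c e1)%:C * g e1 x = v e1 x.
  move=> xI; have := minus e1 x xI.
  rewrite NC mulNr [in RHS]mulNr (dom_root dU) -/(v e1) addNr mulr0 => /eqP.
  by rewrite addrC subr_eq0 => /eqP.
have leaf i x : (3 <= label i <= N)%N -> I01 x -> (c i)%:C * g i x = - v i x.
  move=> i3 xI; have := plus i 1 I01_1; rewrite (dom_leaf dU i3) addNr => /esym/eqP.
  rewrite mulf_eq0 (negbTE (cexp_neq0 _)) /= => /eqP h.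
  by have := plus i x xI; rewrite h mulr0 => /eqP; rewrite addr_eq0 => /eqP.
have n1 : (c e2)%:C * g e2 0 = (k1%:R - 1 - alpha1)%:C * v e2 0.
  by apply: (node1_middle_slope dU) => [|i i3 _]; [exact: root I01_1|exact: leaf I01_0].
have n2 : (c e2)%:C * g e2 1 = (alpha2 - k2%:R + 1)%:C * v e2 1.
  by apply: (node2_middle_slope dU) => i i3 _; exact: leaf I01_0.
pose E := cexp (lambda / (c e2)%:C).
have E0 : E != 0 by exact: cexp_neq0.
have EN : cexp (lambda / (- c e2)%:C * 1%:C) = E^-1.
  have -> : lambda / (- c e2)%:C * 1%:C = - (lambda / (c e2)%:C).
    by rewrite rmorph1 mulr1 NC invrN mulrN.
  by apply: (mulIf E0); rewrite cexpN mulVf.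
pose P := (c e2)%:C * g e2 0 + v e2 0.
pose M := - ((c e2)%:C * g e2 0) + v e2 0.
have p1 : (c e2)%:C * g e2 1 + v e2 1 = E * P.
  by rewrite plus; [rewrite mulr1|exact: I01_1].
have m1 : - ((c e2)%:C * g e2 1) + v e2 1 = E^-1 * M.
  by have := minus e2 1 I01_1; rewrite EN NC mulNr [in RHS]mulNr.
pose a1 : R[i] := (2 + alpha1 - k1%:R)%:C; pose b1 : R[i] := (alpha1 - k1%:R)%:C.
pose a2 : R[i] := (2 + alpha2 - k2%:R)%:C; pose b2 : R[i] := (alpha2 - k2%:R)%:C.
have q1 : a1 * P = - b1 * M.
  rewrite /P /M n1 /a1 /b1 !(rmorphD, rmorphB, rmorphN, rmorph1, rmorph_nat) /=.
  by ring.
have q2 : b2 * (E * P) = - a2 * (E^-1 * M).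
  rewrite -p1 -m1 n2 /a2 /b2 !(rmorphD, rmorphB, rmorphN, rmorph1, rmorph_nat) /=.
  by ring.
have b10 : b1 != 0 by apply/eqP => /complexI/eqP; rewrite subr_eq0 => /eqP.
have b20 : b2 != 0 by apply/eqP => /complexI/eqP; rewrite subr_eq0 => /eqP.
have EV0 : E^-1 != 0 by rewrite invr_eq0.
have P0 : P != 0.
  apply/eqP => P0; apply: Unz.
  have M0 : M = 0.
    apply: (mulfI b10); rewrite mulr0; apply: oppr_inj.
    by rewrite -mulNr -q1 P0 mulr0 oppr0.
  have mid x : I01 x -> v e2 x = 0.
    move=> xI; have := plus e2 x xI; have := minus e2 x xI.
    rewrite NC mulNr [in RHS]mulNr -/P -/M P0 M0 !mulr0 => h h'.
    have : v e2 x + v e2 x = 0.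
      by rewrite -[RHS]addr0 -{1}h -h'; ring.
    by rewrite -mulr2n => /eqP; rewrite mulrn_eq0 => /eqP.
  have leaf0 i x : (3 <= label i <= N)%N -> v i 0 = 0 -> I01 x -> v i x = 0.
    move=> i3 vi0 xI.
    have E1 : (- c i)%:C * g i x = v i x by rewrite NC mulNr leaf// opprK.
    have E2 : (- c i)%:C * g i 0 = 0 by rewrite NC mulNr (leaf _ _ i3 I01_0) vi0 !oppr0.
    have := minus i x xI; rewrite E1 E2 vi0 addr0 mulr0 => /eqP.
    by rewrite -mulr2n mulrn_eq0 => /eqP.
  (* The nodes are at rest, which kills the outgoing invariants. *)
  have v0 i x : I01 x -> v i x = 0.
    move=> xI; case: (edgeP i) => [->|->|i3 io _|i3 io]; first last.
    - have vi0 : v i 0 = 0 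
        by have -> : v i 0 = v e2 1 := dom_velocity2 dU io; exact: mid I01_1.
      exact: leaf0.
    - have vi0 : v i 0 = 0.
        have -> : v i 0 = v e1 1 := dom_velocity1 dU io.
        by have <- : v e2 0 = v e1 1 := dom_velocity1 dU out1_middle; exact: mid I01_0.
      exact: leaf0.
    - exact: mid.
    - have v1 : v e1 1 = 0.
        by have <- : v e2 0 = v e1 1 := dom_velocity1 dU out1_middle; exact: mid I01_0.
      have := plus e1 1 I01_1; rewrite (root 1 I01_1) v1 addr0 => /esym/eqP.
      rewrite mulf_eq0 (negbTE (cexp_neq0 _)) /= => /eqP h.
      have := plus e1 x xI; rewrite h mulr0 (root x xI) => /eqP.
      by rewrite -mulr2n mulrn_eq0 => /eqP.
  move=> i; split=> [x xI|].
    by apply: (mulfI l0); rewrite -vE// v0// mulr0.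
  by apply: aeW => x xI; exact: v0.
have M0 : M != 0.
  apply/eqP => M0; move/eqP: q2; rewrite M0 !mulr0 mulf_eq0 (negbTE b20) /=.
  by rewrite mulf_eq0 (negbTE E0) (negbTE P0).
have a10 : a1 != 0.
  apply/eqP => h; move/eqP: M0; apply; apply: (mulfI b10); rewrite mulr0.
  by apply: oppr_inj; rewrite -mulNr -q1 h mul0r oppr0.
have a20 : a2 != 0.
  apply/eqP => h; move/eqP: q2; rewrite h oppr0 mul0r mulf_eq0 (negbTE b20) /=.
  by rewrite mulf_eq0 (negbTE E0) (negbTE P0).
split.
- by move=> h; move/eqP: a10; apply; rewrite /a1 h; congr (_%:C); ring.
- by move=> h; move/eqP: a20; apply; rewrite /a2 h; congr (_%:C); ring.
rewrite fmorph_div !rmorphM -/a1 -/a2 -/b1 -/b2.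
have -> : 2 * lambda / (c e2)%:C = lambda / (c e2)%:C + lambda / (c e2)%:C.
  by ring.
rewrite cexpD -/E; apply: (mulIf (mulf_neq0 b10 b20)).
rewrite divfK ?mulf_neq0//; apply: (mulIf P0).
have -> : a1 * a2 * P = - b1 * (a2 * M) by rewrite mulrAC q1; ring.
have -> : a2 * M = - (b2 * (E * (E * P))).
  apply: (mulfI EV0); rewrite mulrCA -[LHS]opprK -mulNr -q2 !mulrN; congr (- _).
  by field.
by ring.
Qed.

End Eigenvalues.
End TreeDomain.

(** * Explicit eigenvectors *)

Section ExponentialDerivative.
Context {R : realType}.
Local Notation I01 := (`[0, 1]%classic : set R).
Implicit Types (m : R[i]) (x : R) (s : bool).

Lemma is_derive_cexp m x s : is_derive x 1 (fun t => reim s (cexp (m * t%:C)))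
  (reim s (m * cexp (m * x%:C))).
Proof.
pose p := Re m; pose q := Im m.
have dl (k y : R) : is_derive y 1 (fun t => k * t) k.
  have -> : (fun t => k * t) = (fun t => k *: id t) by [].
  by apply: is_derive_eq; rewrite [_ *: _]mulr1.
have dE := is_derive1_comp (is_derive_expR (p * x)) (dl p x).
have dC := is_derive1_comp (is_derive_cos (q * x)) (dl q x).
have dS := is_derive1_comp (is_derive_sin (q * x)) (dl q x).
have Rm t : Re (m * t%:C) = p * t by rewrite cReM /= mulr0 subr0.
have Im_ t : Im (m * t%:C) = q * t by rewrite cImM /= mulr0 add0r.
case: s.
  have -> : (fun t => reim true (cexp (m * t%:C))) =
     (expR \o (fun t => p * t)) * (cos \o (fun t => q * t)).
    by apply/funext => t; rewrite [LHS]/= Rm Im_.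
  apply: is_derive_eq; rewrite reimMt /= Rm Im_ -/p -/q.
  by rewrite /GRing.scale /=; ring.
have -> : (fun t => reim false (cexp (m * t%:C))) =
   (expR \o (fun t => p * t)) * (sin \o (fun t => q * t)).
  by apply/funext => t; rewrite [LHS]/= Rm Im_.
apply: is_derive_eq; rewrite reimMf /= Rm Im_ -/p -/q.
by rewrite /GRing.scale /=; ring.
Qed.

(** Each coordinate minus the primitive of its derivative has zero right
derivative. *)
Lemma cexp_wderiv m : is_wderiv (fun x => cexp (m * x%:C))
                                (fun x => m * cexp (m * x%:C)).
Proof.
have ce s : continuous (fun t : R => reim s (cexp (m * t%:C))).
  by move=> x; exact: is_derive_cont (is_derive_cexp m x s).
have cme s : continuous (fun t : R => reim s (m * cexp (m * t%:C))).
  move=> x; case: s.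
    rewrite (_ : (fun t => _) = (fun t => Re m * reim true (cexp (m * t%:C)) -
       Im m * reim false (cexp (m * t%:C)))).
      by apply: cvgB; apply: cvgM; (try exact: cvg_cst); exact: ce.
    by apply/funext => t; rewrite reimMt.
  rewrite (_ : (fun t => _) = (fun t => Re m * reim false (cexp (m * t%:C)) +
     Im m * reim true (cexp (m * t%:C)))).
    by apply: cvgD; apply: cvgM; (try exact: cvg_cst); exact: ce.
  by apply/funext => t; rewrite reimMf.
have wcme s := continuous_subspaceT (A := I01) (cme s).
split; first by apply/L2P => s; exact: cont01_sqint.
move=> x; rewrite /= in_itv/= => /andP[x0 x1]; apply: reim_inj => s.
rewrite reimD reim_primitive0.
pose f t := reim s (cexp (m * t%:C)) + - 1 * prim (fun t => reim s (m * cexp (m * t%:C))) t.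
have fx : f x = f 0.
  apply: rder0_const => // t /andP[t0 t1].
    apply: lcontD; first by apply: continuous_lcont; exact: ce.
    apply: lcontZ; apply: cont01_lcont; last by rewrite t0 (le_trans t1).
    by apply: prim_cont01; exact: cont01_integrable.
  apply: rder_eq.
    apply: rderD; first exact: is_derive_rder (is_derive_cexp m t s).
    by apply: rderZ; apply: prim_rder => //; rewrite t0 (lt_le_trans t1).
  by rewrite mulN1r subrr.
by move: fx; rewrite /f prim0 (mulr0 (-1)) addr0 mulN1r => /eqP; rewrite subr_eq => /eqP.
Qed.

End ExponentialDerivative.

Section Eigenfunctions.
Context {R : realType}.
Variables (N k1 k2 : nat).
Hypotheses (hk1 : (2 <= k1)%N) (hk2 : (2 <= k2)%N) (hN : (k1 + k2 = N + 1)%N).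
Variables (e1 e2 : 'I_N).
Hypotheses (he1 : label e1 = 1%N) (he2 : label e2 = 2%N).
Variable c : 'I_N -> R.
Hypothesis hc : forall i, 0 < c i.
Variables (alpha1 alpha2 : R).
Local Notation mu := (@lebesgue_measure R).
Local Notation I01 := (`[0, 1]%classic : set R).
Local Notation out1 := (@out1 N k1).
Local Notation out2 := (@out2 N k1).

(** The hypothesis is the characteristic equation multiplied by lambda, so that
it also holds for lambda = 0, where the construction returns a constant
state. *)
Lemma eigenvalue_of_equation (lambda : R[i]) :
  lambda * (cexp (2 * lambda / (c e2)%:C) *
     ((alpha1 - k1%:R) * (alpha2 - k2%:R))%:C -
     ((2 + alpha1 - k1%:R) * (2 + alpha2 - k2%:R))%:C) = 0 ->
  is_eigenvalue k1 e1 e2 c alpha1 alpha2 lambda.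
Proof.
move=> heq.
pose m i : R[i] := lambda / (c i)%:C.
pose a1 : R[i] := (2 + alpha1 - k1%:R)%:C; pose b1 : R[i] := (alpha1 - k1%:R)%:C.
pose E i := cexp (m i); pose F i := cexp (- m i).
pose q := - b1 * E e2 + a1 * F e2.
(* Normalized so that the value at node 1 is 2; q is the value at node 2. *)
pose A i := if i == e1 then 2 * F e1 else if i == e2 then - b1 else 0.
pose B i := if i == e1 then 0 else if i == e2 then a1 else if out1 i then 2 else q.
pose u i x := A i * cexp (m i * x%:C) + B i * cexp (- m i * x%:C).
pose g i x := A i * (m i * cexp (m i * x%:C)) + B i * (- m i * cexp (- m i * x%:C)).
pose h i x := A i * (m i * (m i * cexp (m i * x%:C))) +
              B i * (- m i * (- m i * cexp (- m i * x%:C))).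
have ug i : is_wderiv (u i) (g i).
  by apply: is_wderiv_lin; [exact: cexp_wderiv|apply: is_wderivZ; exact: cexp_wderiv].
have gh i : is_wderiv (g i) (h i).
  apply: is_wderiv_lin; first by apply: is_wderivZ; exact: cexp_wderiv.
  by do 2 apply: is_wderivZ; exact: cexp_wderiv.
have c0 i : (c i)%:C != 0 :> R[i].
  by apply/eqP => /complexI/eqP; rewrite gt_eqF.
have EF i : E i * F i = 1 by rewrite mulrC /E /F cexpN.
have ce0 z : cexp (z * (0 : R)%:C) = 1 by rewrite mulr0 cexp0.
have ce1 z : cexp (z * (1 : R)%:C) = cexp z by rewrite mulr1.
have u0 i : u i 0 = A i + B i by rewrite /u !ce0 !mulr1.
have u1 i : u i 1 = A i * E i + B i * F i by rewrite /u !ce1.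
pose U : state R N := fun i => (u i, fun x => lambda * u i x).
have cd i x : I01 x -> cderiv (U i).1 x = g i x.
  by have [_ + _] := cderiv_unique (ug i) (gh i); apply.
have cm i : (c i)%:C * m i = lambda by rewrite /m mulrC divfK.
have g0 i : (c i)%:C * cderiv (U i).1 0 = lambda * (A i - B i).
  by rewrite (cd _ _ I01_0) /g !ce0 -(cm i); ring.
have g1 i : (c i)%:C * cderiv (U i).1 1 = lambda * (A i * E i - B i * F i).
  by rewrite (cd _ _ I01_1) /g !ce1 -/(E i) -/(F i) -(cm i); ring.
have e21 : e2 != e1 by apply/eqP => h21; move: he2; rewrite h21 he1.
have A1 : A e1 = 2 * F e1 by rewrite /A eqxx.
have B1 : B e1 = 0 by rewrite /B eqxx.
have A2 : A e2 = - b1 by rewrite /A (negbTE e21) eqxx.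
have B2 : B e2 = a1 by rewrite /B (negbTE e21) eqxx.
have ne i : (3 <= label i <= N)%N -> (i == e1 = false) * (i == e2 = false).
  move=> i3; split; apply/eqP => ie; move: i3; rewrite ie ?he1 ?he2 //.
have A3 i : (3 <= label i <= N)%N -> A i = 0 by move=> /ne i3; rewrite /A !i3.
have B31 i : (3 <= label i <= N)%N -> out1 i -> B i = 2.
  by move=> /ne i3 io; rewrite /B !i3 io.
have B32 i : (3 <= label i <= N)%N -> out2 i -> B i = q.
  move=> /ne i3; rewrite /B !i3 /Defs.out2 /Defs.out1 => io.
  by case: ifP => //; lia.
have ab : - b1 + a1 = 2.
  by rewrite /a1 /b1 !(rmorphD, rmorphN, rmorphB, rmorph_nat) /=; ring.
have u11 : u e1 1 = 2 by rewrite u1 A1 B1 mul0r addr0 -mulrA [F _ * _]mulrC EF mulr1.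
have u21 : u e2 1 = q by rewrite u1 A2 B2.
have cont1 i : out1 i -> u i 0 = u e1 1.
  move=> io; rewrite u11 u0.
  case: (edgeP hk1 hk2 hN he1 he2 i) => [ie|->|i3 _ _|i3 io2].
  - by move: io; rewrite ie /Defs.out1 he1.
  - by rewrite A2 B2.
  - by rewrite A3// B31// add0r.
  - by move: io io2; rewrite /Defs.out1 /Defs.out2; lia.
have cont2 i : out2 i -> u i 0 = u e2 1.
  move=> io; rewrite u21 u0.
  case: (edgeP hk1 hk2 hN he1 he2 i) => [ie|ie|i3 io1 _|i3 _].
  - by move: io; rewrite ie /Defs.out2 he1; lia.
  - by move: io; rewrite ie /Defs.out2 he2; lia.
  - by move: io io1; rewrite /Defs.out1 /Defs.out2; lia.
  - by rewrite A3// B32// add0r.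
exists U; split.
- split.
    move=> i; split; first by have [] := cderiv_unique (ug i) (gh i).
    by eexists; exact: (is_wderivZ lambda (ug i)).
  split; last first.
    split=> i io; first by split; [exact: cont1|rewrite /= (cont1 i io)].
    by split; [exact: cont2|rewrite /= (cont2 i io)].
  split.
  - by rewrite g0 /= u0 B1 subr0 addr0.
  - by move=> i i3; rewrite g1 /= u1 A3//; ring.
  - rewrite (sum_out1 hk1 hk2 hN he1 he2 (p := - (2 * lambda))); last first.
      by move=> i i3 io; rewrite g0 A3// B31//; ring.
    rewrite g0 g1 /= u11 A1 B1 A2 B2 mul0r subr0 -(mulrA 2) [F _ * _]mulrC EF.
    rewrite natrB// /a1 /b1 !(rmorphD, rmorphN, rmorphB, rmorph_nat) /=.
    by ring.
  - rewrite (sum_out2 hk1 hk2 hN he1 he2 (p := - (lambda * q))); last first.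
      by move=> i i3 io; rewrite g0 A3// B32//; ring.
    rewrite g1 /= u21 A2 B2 natrB ?(ltnW hk2)//.
    apply/eqP; rewrite -subr_eq0; apply/eqP.
    have E2 : cexp (2 * lambda / (c e2)%:C) = E e2 * E e2.
      by rewrite /E -cexpD; congr cexp; rewrite /m; ring.
    have E0 : E e2 != 0 by exact: cexp_neq0.
    apply: (mulfI E0); rewrite mulr0 -[RHS]oppr0 -heq E2 /q.
    have -> : F e2 = (E e2)^-1 by apply: (mulfI E0); rewrite EF mulfV.
    rewrite /a1 /b1 !(rmorphD, rmorphN, rmorphB, rmorphM, rmorph_nat) /=.
    by field.
- move=> U0; have [/(_ 1 I01_1) + _] := U0 e1.
  by rewrite /= u11 => /eqP; rewrite pnatr_eq0.
- move=> i; split=> [//|].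
  have [_ _] := cderiv_unique (ug i) (gh i).
  apply: filterS => x + xI => /(_ xI) /= ->.
  have -> : h i x = m i * m i * u i x by rewrite /h /u; ring.
  transitivity (((c i)%:C * m i) * ((c i)%:C * m i) * u i x); last by rewrite cm mulrA.
  by rewrite expr2 rmorphM /=; ring.
Qed.

End Eigenfunctions.

(** * The discrete spectrum *)

Section Spectrum.
Context {R : realType}.
Variables (N k1 k2 : nat).
Hypotheses (hk1 : (2 <= k1)%N) (hk2 : (2 <= k2)%N) (hN : (k1 + k2 = N + 1)%N).
Variables (e1 e2 : 'I_N).
Hypotheses (he1 : label e1 = 1%N) (he2 : label e2 = 2%N).
Variable c : 'I_N -> R.
Hypothesis hc : forall i, 0 < c i.
Variables (alpha1 alpha2 : R).
Hypotheses (ha1 : alpha1 <> k1%:R) (ha2 : alpha2 <> k2%:R).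

Let rho := ((2 + alpha1 - k1%:R) * (2 + alpha2 - k2%:R)) /
           ((alpha1 - k1%:R) * (alpha2 - k2%:R)).

Let lambdaE k : 2 * lambda_ k1 k2 (c e2) alpha1 alpha2 k / (c e2)%:C =
  log_mpi2 rho%:C + (0 +i* (2 * pi * k%:~R)).
Proof.
have c0 : (c e2)%:C != 0 :> R[i] by apply/eqP => /complexI/eqP; rewrite gt_eqF.
apply: (mulIf c0); rewrite divfK// /lambda_ -/rho [LHS]mulrDr [RHS]mulrDl; congr (_ + _).
  by rewrite fmorph_div rmorph_nat; field.
by apply: reim_inj => -[]; rewrite ?reimMt ?reimMf /=; ring.
Qed.

Lemma spectrumE : alpha1 <> k1%:R - 2 -> alpha2 <> k2%:R - 2 ->
  sigma_d k1 e1 e2 c alpha1 alpha2 =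
    [set 0] `|` range (lambda_ k1 k2 (c e2) alpha1 alpha2).
Proof.
move=> ha1' ha2'.
have b0 : (alpha1 - k1%:R) * (alpha2 - k2%:R) != 0.
  by rewrite mulf_neq0// subr_eq0; apply/eqP.
have rho0 : rho != 0.
  rewrite mulf_neq0 ?invr_eq0// mulf_neq0//.
    by rewrite -addrA -[_ + (_ - _)]opprK -subr_eq0 opprK; apply/eqP => h; apply: ha1'; lra.
  by apply/eqP => h; apply: ha2'; lra.
have c0 : (c e2)%:C != 0 :> R[i] by apply/eqP => /complexI/eqP; rewrite gt_eqF.
apply/seteqP; split => lambda /=.
  move=> ev; have [->|l0] := eqVneq lambda 0; [by left|right].
  have [_ _] := nonzero_eigenvalue_equation hk1 hk2 hN he1 he2 hc ha1 ha2 l0 ev.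
  rewrite -/rho -(log_mpi2K rho0) => /cexp_inj[k kE].
  exists k => //; apply: (@mulfI _ 2); first by rewrite pnatr_eq0.
  by apply: (mulIf (invr_neq0 c0)); rewrite lambdaE kE.
move=> [->|[k _ <-]].
  by apply: (eigenvalue_of_equation hk1 hk2 hN he1 he2 hc); rewrite mul0r.
apply: (eigenvalue_of_equation hk1 hk2 hN he1 he2 hc); rewrite lambdaE cexpD cexp_2pi_int mulr1.
by rewrite log_mpi2K// -rmorphM divfK// subrr mulr0.
Qed.

Lemma nonzero_eigenvalueP :
  (exists lambda : R[i],
     lambda <> 0 /\ is_eigenvalue k1 e1 e2 c alpha1 alpha2 lambda) <->
  (alpha1 <> k1%:R - 2 /\ alpha2 <> k2%:R - 2).
Proof.
split=> [[lambda [/eqP l0 ev]]|[h1 h2]].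
  by have [] := nonzero_eigenvalue_equation hk1 hk2 hN he1 he2 hc ha1 ha2 l0 ev.
have ev k : is_eigenvalue k1 e1 e2 c alpha1 alpha2
    (lambda_ k1 k2 (c e2) alpha1 alpha2 k).
  by rewrite -[is_eigenvalue _ _ _ _ _ _ _]/(sigma_d _ _ _ _ _ _ _) spectrumE//; right; exists k.
pose l k := lambda_ k1 k2 (c e2) alpha1 alpha2 k.
have [l0|l0] := eqVneq (l 0) 0; last by exists (l 0); split; [exact/eqP|exact: ev].
exists (l 1); split; last exact: ev.
move=> l1; have : l 1 - l 0 = 0 +i* (c e2 * pi).
  by rewrite /l /lambda_; apply: reim_inj => -[]; rewrite reimB !reimD /=; ring.
rewrite l1 l0 subrr => -[] /esym/eqP.
by rewrite mulf_eq0 gt_eqF//= gt_eqF// pi_gt0.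
Qed.

End Spectrum.

(** * Orbits of eigenvectors *)

Section Trajectories.
Context {R : realType}.
Variables (N k1 : nat) (e1 e2 : 'I_N) (c : 'I_N -> R) (alpha1 alpha2 : R).
Local Notation I01 := (`[0, 1]%classic : set R).
Local Notation inH := (@inH R N k1 e1 e2).
Local Notation domA := (domAT k1 e1 e2 c alpha1 alpha2).
Variable S : R -> state R N -> state R N.
Hypothesis HS : C0_semigroup k1 e1 e2 S.
Hypothesis HG : generates k1 e1 e2 c alpha1 alpha2 S.
Implicit Types (U W V : state R N) (t x : R) (i : 'I_N).

Lemma dom_inH U : domA U -> inH U.
Proof.
move=> [reg [_ [j1 j2]]]; split.
- by move=> i; have [[g [ug _]] vH] := reg i; split; [exists g|exact: H1_L2].
- by move=> i /j1[].
- by move=> i /j2[].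
Qed.

Lemma dom_velocity V W : domA V -> inH W -> eqH (AT c V) W -> has_velocity S V W.
Proof.
move=> dV hW AV; apply/(HG (dom_inH dV) hW).
by exists V; split => //; exact: eqH_refl.
Qed.

Lemma sqr_le_normr (r s : R) : 0 <= s -> r ^+ 2 <= s ^+ 2 -> `|r| <= s.
Proof. by move=> s0; rewrite -[r ^+ 2]real_normK ?num_real// ler_sqr ?nnegrE. Qed.

Let ev i x s (_ : R) U := reim s ((U i).1 x).

Let ev_lin i x s y (r : R) U W : I01 y -> regular U -> regular W ->
  ev i x s y (scaleH r%:C U + W) = r * ev i x s y U + ev i x s y W.
Proof. by move=> _ _ _; rewrite /ev stateD1 reimD stateZ1 reimZ. Qed.

Let ev_bound i x s y U : I01 x -> I01 y -> regular U ->
  `|ev i x s y U| <= 3 * normH U.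
Proof.
move=> xI _ rU; apply: sqr_le_normr; first by rewrite mulr_ge0// normH_ge0.
apply: (le_trans (reim_sq_le _ _)); apply: (le_trans (edge_sup_le i rU xI)).
by rewrite exprMn normH_energy; have := energy_ge0 U; lra.
Qed.

Lemma trajectory_lcont U i x s t : inH U -> I01 x -> 0 < t ->
  lcont (fun r => reim s ((S r U i).1 x)) t.
Proof.
move=> hU xI t0.
apply: (moving_lcont (F := ev i x s) (K := 3) HS _ (ev_lin i x s)
  (fun y U => @ev_bound i x s y U xI) (x := fun=> 0)) => //.
  by exists 1 => // r _ _; exact: I01_0.
exact: cvg_cst.
Qed.

(** For fixed i and x the point does not move, so only the velocity of the
orbit contributes. *)
Lemma trajectory_rder U W i x s t : inH U -> inH W -> has_velocity S U W ->
  I01 x -> 0 <= t ->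
  rder (fun r => reim s ((S r U i).1 x)) t (reim s ((S t W i).1 x)).
Proof.
move=> hU hW vel xI t0.
rewrite -[reim s (_.1 x)]addr0.
apply: (moving_rder (F := ev i x s) (K := 3) HS _ (ev_lin i x s)
  (fun y U => @ev_bound i x s y U xI) (x := fun=> 0) (m := 0)) => //.
- by exists 1 => // r _ _; exact: I01_0.
- exact: cvg_cst.
- exact: rder_cst.
Qed.

(** Along the orbit of an eigenvector the value u_i(x) satisfies
y' = lambda y. *)
Lemma eigen_trajectory U (lambda : R[i]) i x t : domA U ->
  eqH (AT c U) (scaleH lambda U) -> I01 x -> 0 <= t ->
  (S t U i).1 x = cexp (lambda * t%:C) * (U i).1 x.
Proof.
move=> dU AU xI t0; have hU := dom_inH dU.
have hW : inH (scaleH lambda U) := inHZ _ hU.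
have vel := dom_velocity dU hW AU.
have [+ _] := sg_zero HS hU i; move=> /(_ x xI) <-.
rewrite -[in t%:C](subr0 t).
apply: (exp_of_rder (y := fun r => (S r U i).1 x)) => //.
  by move=> s r /andP[r0 _]; exact: trajectory_lcont.
move=> s r /andP[r0 _]; apply: rder_eq; first exact: trajectory_rder vel xI r0.
congr reim; have [+ _] := sg_scale HS lambda r0 hU i.
by apply.
Qed.

(** If u_i(x) exp (lambda t) is eventually constant with u_i(x) <> 0 then
exp (lambda r) = 1 for all r >= 0, and differentiating at 0 gives
lambda = 0. *)
Lemma nonzero_eigenvalue_unstable lambda : lambda <> 0 ->
  is_eigenvalue k1 e1 e2 c alpha1 alpha2 lambda ->
  ~ finite_time_stable k1 e1 e2 S.
Proof.
move=> l0 [U [dU Unz AU]] stab.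
have hU := dom_inH dU; have [T T0 [C TC]] := stab U hU.
have u0 i x : I01 x -> (U i).1 x = 0.
  move=> xI; apply/eqP; apply: contra_notT l0 => unz.
  have one r : 0 <= r -> cexp (lambda * r%:C) = 1.
    move=> r0; have := TC (T + r) _ i x xI; rewrite lerDl => /(_ r0).
    rewrite -(TC T (lexx T) i x xI) !(eigen_trajectory _ dU AU) ?addr_ge0//.
    rewrite rmorphD mulrDr cexpD -mulrA [X in _ * X = _]mulrC mulrA => h.
    by apply: (mulIf (mulf_neq0 (cexp_neq0 (lambda * T%:C)) unz));
      rewrite mul1r -[RHS]h; ring.
  apply: reim_inj => s.
  have d1 := is_derive_rder (is_derive_cexp lambda 0 s).
  have d2 : rder (fun t => reim s (cexp (lambda * t%:C))) 0 0.
    apply/rderP => e e0; exists 1 => // h h0 _.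
    by rewrite add0r (one h (ltW h0)) (one 0 (lexx 0)) mulr0 subrr subr0 normr0 mulr_ge0// ltW.
  have := rder_uniq d1 d2; rewrite (one 0 (lexx 0)) mulr1 => ->.
  by case: s {d1 d2}.
apply: Unz => i; split=> [x xI|]; first exact: u0.
apply: aeW => x xI; have [+ _] := AU i; move=> /(_ x xI) /= ->.
by rewrite u0// mulr0.
Qed.

End Trajectories.

(** * Transport of the Riemann invariants along orbits *)

Section Transport.
Context {R : realType}.
Variables (N k1 : nat) (e1 e2 : 'I_N) (c : 'I_N -> R) (alpha1 alpha2 : R).
Local Notation I01 := (`[0, 1]%classic : set R).
Local Notation inH := (@inH R N k1 e1 e2).
Local Notation domA := (domAT k1 e1 e2 c alpha1 alpha2).
Variable S : R -> state R N -> state R N.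
Hypothesis HS : C0_semigroup k1 e1 e2 S.
Hypothesis HG : generates k1 e1 e2 c alpha1 alpha2 S.
Implicit Types (U : state R N) (t x r : R) (i : 'I_N) (s : bool).

Variables (V W : state R N).
Hypotheses (dV : domA V) (hW : inH W) (AV : eqH (AT c V) W).

Let hV : inH V := dom_inH dV.
Let vel : has_velocity S V W := dom_velocity HG dV hW AV.

(** The space derivative of the orbit of V, in its continuous version. *)
Definition slope t i := cderiv (S t V i).1.
(** The time derivative of the orbit of V.  It is read off from the orbit of
W = AV, whose first component is continuous, whereas the second component of
S t V is only defined almost everywhere. *)
Definition velocity t i := (S t W i).1.

(** The domain is invariant and S commutes with A: the orbit of V has velocity
S t W at each time, so the description of the generator applies to S t V. *)
Lemma trajectory_domain t : 0 <= t -> exists V', [/\ domA V',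
  eqH (S t V) V', eqH (AT c V') (S t W),
  forall i, cderiv (V' i).1 = slope t i &
  forall i x, I01 x -> (V' i).2 x = velocity t i x].
Proof.
move=> t0; have [sV sW] := (sg_stable HS t0 hV, sg_stable HS t0 hW).
have : normH (scaleH (h^-1)%:C (S h (S t V) - S t V) - S t W) @[h --> 0^'+] --> 0.
  apply/cvgrPdist_lt => e e0.
  have [k k0 hk] := has_velocity_at HS t0 hV hW vel e0.
  exists k => //= h /=; rewrite !sub0r !normrN => hk' h0.
  rewrite (gtr0_norm h0) in hk'; rewrite ger0_norm ?normH_ge0//.
  apply: le_lt_trans (hk h h0 hk'); rewrite le_eqVlt; apply/orP; left; apply/eqP.
  have th0 : 0 <= t + h by rewrite addr_ge0// ltW.
  have sth := sg_stable HS th0 hV.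
  have shs := sg_stable HS (ltW h0) sV.
  have rg A B : inH A -> inH B -> regular (scaleH (h^-1)%:C (A - B) - S t W).
    by move=> hA hB; exact: (inH_regular (inHB (inHZ _ (inHB hA hB)) sW)).
  apply: normH_eqH; [exact: rg|exact: rg|].
  apply: eqHB; last exact: eqH_refl.
  rewrite [X in eqH X _]scaleHE [X in eqH _ X]scaleHE.
  have E : eqH (S h (S t V) - S t V) (S (t + h) V - S t V).
    apply: eqHB; last exact: eqH_refl.
    by rewrite addrC; apply: eqH_sym; apply: (sg_add HS) => //; exact: ltW.
  exact: eqH_lin.
move/(HG sV sW) => [V' [SV dV' AV']]; exists V'; split => //.
  by move=> i; apply: cderiv_congr => x xI; have [-> ] := SV i.
by move=> i x xI; have [h _] := AV' i; exact: h.
Qed.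

Definition riemann t i r x := r%:C * slope t i x + velocity t i x.

Lemma slope_H1 t i : 0 <= t -> H1 (slope t i).
Proof.
by move=> t0; have [V' [dV' _ _ <- _]] := trajectory_domain t0; exact: (dom_cderiv_H1 dV').
Qed.

Lemma velocity_H1 t i : 0 <= t -> H1 (velocity t i).
Proof. by move=> t0; have [+ _ _] := sg_stable HS t0 hW => /(_ i)[]. Qed.

Lemma riemann_H1 t i r : 0 <= t -> H1 (riemann t i r).
Proof. by move=> t0; apply: H1_lin; [exact: slope_H1|exact: velocity_H1]. Qed.

(** A primitive in x of the Riemann invariant r u' + v.  Unlike the invariant
itself it is a bounded functional on the energy space, uniformly in x. *)
Definition potential i r s x U :=
  reim s (r%:C * (U i).1 x + primitive0 (U i).2 x).

Lemma potential_lin i r s x (a : R) U X : I01 x -> regular U -> regular X ->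
  potential i r s x (scaleH a%:C U + X) =
  a * potential i r s x U + potential i r s x X.
Proof.
move=> xI rU rX; rewrite /potential.
have x1 : x <= 1 by move: xI; rewrite /= in_itv/= => /andP[].
have [[_ lU] [_ lX]] := (rU i, rX i).
rewrite -reimZ -reimD; congr reim.
rewrite stateD1 stateZ1.
have -> : ((scaleH a%:C U + X) i).2 = (fun y => a%:C * (U i).2 y + (X i).2 y) by [].
by rewrite primitive0_lin//; ring.
Qed.

Lemma potential_bound i r s x U : I01 x -> regular U ->
  `|potential i r s x U| <= (4 * `|r| + 2) * normH U.
Proof.
move=> xI rU; have r0 := normr_ge0 r.
apply: sqr_le_normr; first by rewrite mulr_ge0 ?normH_ge0// addr_ge0// mulr_ge0.
apply: (le_trans (reim_sq_le _ _)); apply: (le_trans (sqmodD_le _ _)).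
rewrite sqmodM sqmodC -[r ^+ 2]real_normK ?num_real//.
rewrite exprMn normH_energy.
have h1 := edge_sup_le i rU xI; have h2 := edge_primitive_le i rU xI.
have h3 := energy_ge0 U; have := sqr_ge0 `|r|.
set q := `|r| ^+ 2 => q0.
have : q * sqmod ((U i).1 x) <= q * (8 * energy U) by rewrite ler_wpM2l.
have -> : (4 * `|r| + 2) ^+ 2 = 16 * q + 16 * `|r| + 4 by rewrite /q; ring.
have : 0 <= `|r| * energy U by rewrite mulr_ge0.
by lra.
Qed.

Lemma potential_trajectory t i r s x : 0 <= t -> I01 x ->
  potential i r s x (S t V) = reim s (r%:C * (S t V i).1 0) +
    prim (fun y => reim s (riemann t i r y)) x.
Proof.
move=> t0 xI; have x1 : x <= 1 by move: xI; rewrite /= in_itv/= => /andP[].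
have [V' [dV' SV _ gE vE]] := trajectory_domain t0.
have [ug _] := cderivP (dom_H2 dV' i); rewrite gE in ug.
have uE : is_wderiv (S t V i).1 (slope t i).
  by apply: is_wderiv_congr ug => y yI; have [-> ] := SV i.
have [_ lV] := inH_regular (sg_stable HS t0 hV) i.
have lg := H1_L2 (slope_H1 i t0); have lv := H1_L2 (velocity_H1 i t0).
rewrite -reim_primitive0 -reimD; congr reim.
rewrite (proj2 uE x xI) (@primitive0_ae _ (S t V i).2 (velocity t i))//; last first.
  have [_] := SV i; apply: filterS => y /= E yI; rewrite E//; exact: vE.
by rewrite primitive0_lin//; ring.
Qed.

(** In terms of the orbit of V this is the time derivative of the potential:
r v + int_0^x r^2 u''.  Its dependence on x is exactly cancelled by a motion of
x with velocity -r. *)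
Lemma potential_velocity t i r s x : 0 <= t -> I01 x -> r ^+ 2 = c i ^+ 2 ->
  potential i r s x (S t W) = r * reim s (riemann t i r x) +
    - (r ^+ 2 * reim s (slope t i 0)).
Proof.
move=> t0 xI rc; have x1 : x <= 1 by move: xI; rewrite /= in_itv/= => /andP[].
have [V' [dV' _ AV' gE _]] := trajectory_domain t0.
have gw := wderivP (slope_H1 i t0).
have [_ lW] := inH_regular (sg_stable HS t0 hW) i.
rewrite -!reimZ -reimN -reimD; congr reim.
rewrite -(@primitive0_ae _ (fun y => (c i ^+ 2)%:C * wderiv (slope t i) y))//.
- rewrite primitive0Z//; last by case: gw.
  have -> : primitive0 (wderiv (slope t i)) x = slope t i x - slope t i 0.
    by rewrite (proj2 gw x xI) addrC addKr.
  by rewrite /riemann -rc rmorphXn/= -/(velocity t i); ring.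
- by apply: L2Z; case: gw.
- by have [_] := AV' i; rewrite /= gE.
Qed.

Lemma affine_prim_rder (f : R -> R) (a b t : R) : {within I01, continuous f} ->
  I01 (a + b * t) ->
  (exists2 k, 0 < k & forall h, 0 < h -> h < k -> I01 (a + b * (t + h))) ->
  rder (fun y => prim f (a + b * y)) t (b * f (a + b * t)).
Proof.
move=> cf xI [k k0 hk]; apply/rderP => e e0.
have b0 : 0 < `|b| + 1 by rewrite ltr_wpDl.
have e'0 : 0 < e / (`|b| + 1) by rewrite divr_gt0.
have [d d0 hd] := prim_diff cf xI e'0.
exists (Num.min k (d / (`|b| + 1))); first by rewrite lt_min k0 divr_gt0.
move=> h h0; rewrite lt_min => /andP[hk' hd'].
have E : a + b * (t + h) - (a + b * t) = b * h by ring.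
have := hd _ (hk h h0 hk'); rewrite E normrM (gtr0_norm h0).
have bh : `|b| * h <= (`|b| + 1) * h by apply: ler_wpM2r; [exact: ltW|rewrite lerDl].
have -> : `|b| * h < d.
  by apply: (le_lt_trans bh); rewrite mulrC -ltr_pdivlMr.
move=> /(_ isT) H.
have -> : h * (b * f (a + b * t)) = b * h * f (a + b * t) by ring.
apply: (le_trans H); rewrite -mulrA ler_wpM2l ?(ltW e0)//.
by rewrite ler_pdivrMl.
Qed.

Lemma affine_cont (f : R -> R) (a b t e : R) : {within I01, continuous f} ->
  I01 (a + b * t) -> 0 < e -> exists2 d, 0 < d & forall y, I01 (a + b * y) ->
    `|y - t| < d -> `|f (a + b * y) - f (a + b * t)| < e.
Proof.
move=> cf xI e0; have b0 : 0 < `|b| + 1 by rewrite ltr_wpDl.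
have [d d0 hd] := cont01P cf xI e0.
exists (d / (`|b| + 1)); first by rewrite divr_gt0.
move=> y yI yt; apply: hd => //.
have -> : a + b * y - (a + b * t) = b * (y - t) by ring.
rewrite normrM; move: yt; rewrite ltr_pdivlMr// => yt.
by apply: le_lt_trans yt; rewrite mulrC ler_wpM2l// lerDl.
Qed.

Section MovingPoint.
Variables (i : 'I_N) (r x0 x1 t0 t1 : R) (s : bool).
Hypotheses (rc : r ^+ 2 = c i ^+ 2) (t00 : 0 <= t0) (t01 : t0 < t1).
Hypotheses (xI0 : I01 x0) (xI1 : I01 x1) (x10 : x0 = x1 + r * (t1 - t0)).

Let path t := x0 + r * t0 + - r * t.

Let path0 : path t0 = x0. Proof. by rewrite /path; ring. Qed.
Let path1 : path t1 = x1. Proof. by rewrite /path x10; ring. Qed.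

Let K0 : 0 <= 4 * `|r| + 2. Proof. by rewrite addr_ge0// mulr_ge0. Qed.

Let pathI t : t0 <= t <= t1 -> I01 (path t).
Proof.
move=> /andP[h0 h1]; have L : 0 < t1 - t0 by rewrite subr_gt0.
pose q := (t - t0) / (t1 - t0).
have q0 : 0 <= q by rewrite divr_ge0// subr_ge0// ltW.
have q1 : q <= 1 by rewrite ler_pdivrMr// mul1r lerD2r.
have E : path t = (1 - q) * x0 + q * x1.
  have qE : q * (t1 - t0) = t - t0 by rewrite divfK// gt_eqF.
  have -> : path t = x0 - r * (t - t0) by rewrite /path; ring.
  by rewrite -qE x10; ring.
move: xI0 xI1; rewrite E /= !in_itv/= => /andP[a0 a1] /andP[b0 b1].
by apply/andP; split; nra.
Qed.

Lemma moving_potential_lcont t : t0 < t <= t1 ->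
  lcont (fun y => potential i r s (path y) (S y V)) t.
Proof.
move=> /andP[h0 h1]; have t_gt0 : 0 < t by exact: le_lt_trans h0.
have tI : t0 <= t <= t1 by rewrite h1 ltW.
apply: (moving_lcont (F := potential i r s) HS K0 (@potential_lin i r s)
   (@potential_bound i r s)) => //.
- exists (t - t0); first by rewrite subr_gt0.
  move=> y y0 yt; apply: pathI; rewrite (le_trans yt)// andbT.
  by move: y0; rewrite subKr => /ltW.
apply/lcontP => e e0.
have ci := prim_cont01 (cont01_integrable (H1_cont (riemann_H1 i r (ltW t_gt0)) s)).
have [d d0 hd] := affine_cont ci (pathI tI) e0.
exists (Num.min d (t - t0)); first by rewrite lt_min d0 subr_gt0.
move=> y dy yt.
have m1 : Num.min d (t - t0) <= d by rewrite ge_min lexx.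
have m2 : Num.min d (t - t0) <= t - t0 by rewrite ge_min lexx orbT.
have yI : I01 (path y) by apply: pathI; apply/andP; split; lra.
rewrite !potential_trajectory ?(ltW t_gt0)//; last exact: pathI.
rewrite opprD addrACA subrr add0r; apply: hd => //.
by rewrite ltr0_norm ?subr_lt0//; lra.
Qed.

(** The value does not depend on the characteristic that is followed. *)
Lemma moving_potential_rder t : t0 <= t < t1 ->
  rder (fun y => potential i r s (path y) (S y V)) t
    (- (r ^+ 2 * reim s (slope t i 0))).
Proof.
move=> /andP[h0 h1]; have t_ge0 : 0 <= t by exact: le_trans h0.
have tI : t0 <= t <= t1 by rewrite h0 ltW.
have near h : 0 < h -> h < t1 - t -> I01 (path (t + h)).
  by move=> hh hh'; apply: pathI; apply/andP; split; lra.
have L : 0 < t1 - t by rewrite subr_gt0.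
have E : - (r ^+ 2 * reim s (slope t i 0)) =
    potential i r s (path t) (S t W) + - r * reim s (riemann t i r (path t)).
  by rewrite potential_velocity//; [ring|exact: pathI].
rewrite E; apply: (moving_rder (F := potential i r s) HS K0 (@potential_lin i r s)
   (@potential_bound i r s)) => //.
- exists (t1 - t) => // y y0 yt; apply: pathI; apply/andP; split; lra.
- apply/cvgrPdist_lt => e e0.
  have r0 : 0 < `|r| + 1 by rewrite ltr_wpDl.
  have [d d0 hd] := affine_cont (H1_cont (riemann_H1 i r t_ge0) s) (pathI tI)
    (divr_gt0 e0 r0).
  exists (Num.min d (t1 - t)) => /=; first by rewrite lt_min d0.
  move=> h /=; rewrite sub0r normrN lt_min => /andP[hd1 hd2] hh.
  rewrite (gtr0_norm hh) in hd1 hd2.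
  have thI := near h hh hd2.
  rewrite !potential_velocity//; last exact: pathI.
  rewrite opprD addrACA subrr addr0 -mulrBr normrM distrC.
  have := hd _ thI; rewrite [t + h]addrC addrK (gtr0_norm hh) => /(_ hd1).
  rewrite ltr_pdivlMr// [h + t]addrC => H; apply: le_lt_trans H.
  by rewrite mulrC ler_wpM2l// lerDl.
- have rd : rder (fun y => reim s (r%:C * (S t V i).1 0) +
      prim (fun y => reim s (riemann t i r y)) (path y)) t
      (0 + - r * reim s (riemann t i r (path t))).
    apply: rderD; first exact: rder_cst.
    apply: affine_prim_rder; [exact: (H1_cont (riemann_H1 i r t_ge0) s)|exact: pathI|].
    by exists (t1 - t).
  rewrite add0r in rd; apply/rderP => e e0; have /rderP/(_ e e0)[d d0 hd] := rd.
  exists (Num.min d (t1 - t)); first by rewrite lt_min d0.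
  move=> h hh; rewrite lt_min => /andP[hd1 hd2].
  by rewrite !potential_trajectory//; [exact: hd|exact: pathI|exact: near].
Qed.

End MovingPoint.

(** The difference of the potentials along two characteristics is conserved, so
the primitives of the invariant at the two times have the same increments on
the common part of the intervals. *)
Lemma riemann_transport_short t0 t1 i r x : r ^+ 2 = c i ^+ 2 -> 0 <= t0 ->
  t0 < t1 -> `|r * (t1 - t0)| < 1 -> I01 x -> I01 (x + r * (t1 - t0)) ->
  riemann t1 i r x = riemann t0 i r (x + r * (t1 - t0)).
Proof.
move=> rc t00 t01 short xI xI'; apply: reim_inj => s.
have t10 : 0 <= t1 by lra.
apply: (@shifted_prim_inj _ (fun y => reim s (riemann t1 i r y))
   (fun y => reim s (riemann t0 i r y))) => //.
- exact: (H1_cont (riemann_H1 i r t10) s).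
- exact: (H1_cont (riemann_H1 i r t00) s).
move=> y yI yI'.
pose path z t := z + r * (t1 - t0) + r * t0 + - r * t.
have path0 z : path z t0 = z + r * (t1 - t0) by rewrite /path; ring.
have path1 z : path z t1 = z by rewrite /path; ring.
have lc z t : I01 z -> I01 (z + r * (t1 - t0)) -> t0 < t <= t1 ->
    lcont (fun t => potential i r s (path z t) (S t V)) t.
  by move=> zI zI'; exact: (moving_potential_lcont t00 t01 zI' zI erefl).
have rd z t : I01 z -> I01 (z + r * (t1 - t0)) -> t0 <= t < t1 ->
    rder (fun t => potential i r s (path z t) (S t V)) t
      (- (r ^+ 2 * reim s (slope t i 0))).
  by move=> zI zI'; exact: (moving_potential_rder rc t00 t01 zI' zI erefl).
pose f t := potential i r s (path y t) (S t V) +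
            -1 * potential i r s (path x t) (S t V).
have : f t1 = f t0.
  apply: rder0_const => [|t ht|t ht]; first exact: ltW.
    by apply: lcontD; [exact: lc|apply: lcontZ; exact: lc].
  apply: rder_eq; first by apply: rderD; [exact: rd|apply: rderZ; exact: rd].
  by rewrite mulN1r subrr.
rewrite /f !path0 !path1 !mulN1r !potential_trajectory//.
set p1 := prim _ y; set p2 := prim _ x; set p3 := prim _ _; set p4 := prim _ _.
by lra.
Qed.

(** A displacement of length 1 leaves a single common point, so the motion is
cut into two halves. *)
Lemma riemann_transport t0 t1 i r x : r ^+ 2 = c i ^+ 2 -> 0 <= t0 ->
  t0 <= t1 -> I01 x -> I01 (x + r * (t1 - t0)) ->
  riemann t1 i r x = riemann t0 i r (x + r * (t1 - t0)).
Proof.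
move=> rc t00; rewrite le_eqVlt => /predU1P[<- _ _|t01 xI xI'].
  by rewrite subrr mulr0 addr0.
pose t2 := (t0 + t1) / 2; pose l := r * (t1 - t0).
have [t02 t21] : t0 < t2 /\ t2 < t1 by rewrite /t2; split; lra.
have l2 : r * (t1 - t2) = l / 2 by rewrite /l /t2; field.
have l2' : r * (t2 - t0) = l / 2 by rewrite /l /t2; field.
have [a0 a1] : 0 <= x /\ x <= 1 by move: xI; rewrite /= in_itv/= => /andP[].
have [b0 b1] : 0 <= x + l /\ x + l <= 1.
  by move: xI'; rewrite -/l /= in_itv/= => /andP[].
have l1 : `|l / 2| < 1 by rewrite ltr_norml; apply/andP; split; lra.
have mI : I01 (x + l / 2) by rewrite /= in_itv/=; apply/andP; split; lra.
rewrite (@riemann_transport_short t2)//; rewrite ?l2//; last by lra.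
rewrite (@riemann_transport_short t0 t2)//; rewrite ?l2'//.
  by congr riemann; rewrite -/l; field.
by have -> : x + l / 2 + l / 2 = x + l by field.
Qed.

End Transport.

(** * Finite-time stability *)

Section FiniteTime.
Context {R : realType}.
Variables (N k1 k2 : nat).
Hypotheses (hk1 : (2 <= k1)%N) (hk2 : (2 <= k2)%N) (hN : (k1 + k2 = N + 1)%N).
Variables (e1 e2 : 'I_N).
Hypotheses (he1 : label e1 = 1%N) (he2 : label e2 = 2%N).
Variable c : 'I_N -> R.
Hypothesis hc : forall i, 0 < c i.
Variables (alpha1 alpha2 : R).
Local Notation mu := (@lebesgue_measure R).
Local Notation I01 := (`[0, 1]%classic : set R).
Local Notation inH := (@inH R N k1 e1 e2).
Local Notation domA := (domAT k1 e1 e2 c alpha1 alpha2).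
Local Notation out1 := (@out1 N k1).
Local Notation out2 := (@out2 N k1).
Implicit Types (U : state R N) (t x r : R) (i : 'I_N).

Section Drain.
Variable S : R -> state R N -> state R N.
Hypothesis HS : C0_semigroup k1 e1 e2 S.
Hypothesis HG : generates k1 e1 e2 c alpha1 alpha2 S.
Variables (V W : state R N).
Hypotheses (dV : domA V) (hW : inH W) (AV : eqH (AT c V) W).
Local Notation rie := (riemann S V W).
Local Notation slo := (slope S V).
Local Notation vlc := (velocity S W).

Let tau := \sum_i (c i)^-1.

Let ctau i : (c i)^-1 <= tau.
Proof.
by rewrite /tau (bigD1 i)//= lerDl sumr_ge0// => j _; rewrite invr_ge0 ltW.
Qed.

Let tau0 : 0 <= tau.
Proof. by apply: sumr_ge0 => j _; rewrite invr_ge0 ltW. Qed.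

Let transport t0 t1 i r x : r ^+ 2 = c i ^+ 2 -> 0 <= t0 ->
  t0 <= t1 -> I01 x -> I01 (x + r * (t1 - t0)) ->
  rie t1 i r x = rie t0 i r (x + r * (t1 - t0)) :=
  @riemann_transport R N k1 e1 e2 c alpha1 alpha2 S HS HG V W dV hW AV t0 t1 i r x.

Let ci0 i : 0 < (c i)^-1. Proof. by rewrite invr_gt0. Qed.

(** When nothing enters at x = 1, the invariant moving towards x = 0 at time t
at the point x was at the point 1 at the earlier time t - (1 - x) / c. *)
Lemma drain_forward T i : 0 <= T -> (forall t, T <= t -> rie t i (c i) 1 = 0) ->
  forall t x, T + tau <= t -> I01 x -> rie t i (c i) x = 0.
Proof.
move=> T0 h t x tT xI; move: (xI); rewrite /= in_itv/= => /andP[x0 x1].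
pose t0 := t - (1 - x) * (c i)^-1.
have d0 : 0 <= (1 - x) * (c i)^-1 by rewrite mulr_ge0 ?subr_ge0// ltW.
have d1 : (1 - x) * (c i)^-1 <= (c i)^-1 by apply: ler_piMl; [exact: ltW|lra].
have ct := ctau i.
have E : x + c i * (t - t0) = 1.
  have c0 : c i != 0 by rewrite gt_eqF.
  have -> : t - t0 = (1 - x) * (c i)^-1 by rewrite /t0; ring.
  by rewrite mulrCA mulfV// mulr1; ring.
rewrite (transport (t0 := t0))//; rewrite ?E.
- by apply: h; rewrite /t0; lra.
- by rewrite /t0; lra.
- by rewrite /t0; lra.
- exact: I01_1.
Qed.

Lemma drain_backward T i : 0 <= T -> (forall t, T <= t -> rie t i (- c i) 0 = 0) ->
  forall t x, T + tau <= t -> I01 x -> rie t i (- c i) x = 0.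
Proof.
move=> T0 h t x tT xI; move: (xI); rewrite /= in_itv/= => /andP[x0 x1].
pose t0 := t - x * (c i)^-1.
have d0 : 0 <= x * (c i)^-1 by rewrite mulr_ge0// ltW.
have d1 : x * (c i)^-1 <= (c i)^-1 by apply: ler_piMl => //; exact: ltW.
have ct := ctau i.
have E : x + - c i * (t - t0) = 0.
  have c0 : c i != 0 by rewrite gt_eqF.
  have -> : t - t0 = x * (c i)^-1 by rewrite /t0; ring.
  by rewrite mulrCA mulNr mulfV// mulrN1 subrr.
rewrite (transport (t0 := t0)) ?sqrrN//; rewrite ?E.
- by apply: h; rewrite /t0; lra.
- by rewrite /t0; lra.
- by rewrite /t0; lra.
- exact: I01_0.
Qed.

Let dom t : 0 <= t -> exists V', [/\ domA V',
  forall i, cderiv (V' i).1 = slo t i & forall i x, I01 x -> (V' i).2 x = vlc t i x].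
Proof.
move=> t0; have [V' [dV' _ _ gE vE]] := trajectory_domain HS HG dV hW AV t0.
by exists V'.
Qed.

Let root0 t : 0 <= t -> rie t e1 (- c e1) 0 = 0.
Proof.
move=> t0; have [V' [dV' gE vE]] := dom t0; have := dom_root dV'.
rewrite gE vE; last exact: I01_0.
by rewrite /riemann rmorphN mulNr => ->; rewrite addNr.
Qed.

Let leaf1 t i : 0 <= t -> (3 <= label i <= N)%N -> rie t i (c i) 1 = 0.
Proof.
move=> t0 i3; have [V' [dV' gE vE]] := dom t0; have := dom_leaf dV' i3.
rewrite gE vE; last exact: I01_1.
by rewrite /riemann => ->; rewrite addNr.
Qed.

Let rootT t x : tau <= t -> I01 x -> rie t e1 (- c e1) x = 0.
Proof.
move=> ht xI; apply: (drain_backward (lexx 0) _ _ xI); last by rewrite add0r.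
exact: root0.
Qed.

Let leafT t i x : tau <= t -> (3 <= label i <= N)%N -> I01 x -> rie t i (c i) x = 0.
Proof.
move=> ht i3 xI; apply: (drain_forward (lexx 0) _ _ xI); last by rewrite add0r.
by move=> s s0; exact: leaf1.
Qed.

Let plus0 t i x : rie t i (c i) x = 0 -> (c i)%:C * slo t i x = - vlc t i x.
Proof. by move/eqP; rewrite addr_eq0 => /eqP. Qed.

Let minus0 t i x : rie t i (- c i) x = 0 -> (c i)%:C * slo t i x = vlc t i x.
Proof. by move/eqP; rewrite /riemann rmorphN mulNr addrC subr_eq0 => /eqP. Qed.

Let plus0' t i x : (c i)%:C * slo t i x = - vlc t i x -> rie t i (c i) x = 0.
Proof. by move=> h; rewrite /riemann h addNr. Qed.

Let minus0' t i x : (c i)%:C * slo t i x = vlc t i x -> rie t i (- c i) x = 0.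
Proof. by move=> h; rewrite /riemann rmorphN mulNr h addNr. Qed.

Let node1 t : tau <= t ->
  (c e2)%:C * slo t e2 0 = (k1%:R - 1 - alpha1)%:C * vlc t e2 0.
Proof.
move=> ht; have [V' [dV' gE vE]] := dom (le_trans tau0 ht).
have := node1_middle_slope hk1 hk2 hN he1 he2 dV'.
rewrite !gE !vE; [|exact: I01_0|exact: I01_1].
apply; first exact: minus0 (rootT ht I01_1).
move=> i i3 _; rewrite gE vE; last exact: I01_0.
exact: plus0 (leafT ht i3 I01_0).
Qed.

Let node2 t : tau <= t ->
  (c e2)%:C * slo t e2 1 = (alpha2 - k2%:R + 1)%:C * vlc t e2 1.
Proof.
move=> ht; have [V' [dV' gE vE]] := dom (le_trans tau0 ht).
have := node2_middle_slope hk1 hk2 hN he1 he2 dV'.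
rewrite !gE !vE; last exact: I01_1.
apply; move=> i i3 _; rewrite gE vE; last exact: I01_0.
exact: plus0 (leafT ht i3 I01_0).
Qed.

Let both0 t i x : rie t i (c i) x = 0 -> rie t i (- c i) x = 0 -> vlc t i x = 0.
Proof.
move=> /plus0 h /minus0; rewrite h => /eqP.
by rewrite eq_sym -addr_eq0 -mulr2n mulrn_eq0 => /eqP.
Qed.

Let T2 : 0 <= tau + tau. Proof. by rewrite addr_ge0. Qed.

(** Node 1 does not reflect: the invariant leaving node 1 dies first; then node 2
receives nothing, and the relation alpha2 <> k2 forces its velocity to vanish,
so that the other invariant dies too. *)
Lemma middle_drains_node1 : alpha1 = k1%:R - 2 -> alpha2 <> k2%:R ->
  forall t x, tau + tau + tau <= t -> I01 x -> vlc t e2 x = 0.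
Proof.
move=> a1 a2.
have M t x : tau + tau <= t -> I01 x -> rie t e2 (- c e2) x = 0.
  apply: (drain_backward tau0) => s hs; apply: minus0'; rewrite node1// a1.
  have -> : k1%:R - 1 - (k1%:R - 2) = 1 :> R by ring.
  by rewrite mul1r.
have P t x : tau + tau + tau <= t -> I01 x -> rie t e2 (c e2) x = 0.
  apply: (drain_forward T2) => s hs.
  have ts : tau <= s by have := tau0; lra.
  have h := minus0 (M s 1 hs I01_1); have := node2 ts; rewrite h => h2.
  have v0 : vlc s e2 1 = 0.
    have : (alpha2 - k2%:R)%:C * vlc s e2 1 = 0.
      have -> : (alpha2 - k2%:R)%:C = (alpha2 - k2%:R + 1)%:C - 1 :> R[i].
        by rewrite [in RHS]rmorphD rmorph1 addrK.
      by rewrite mulrBl -h2 mul1r subrr.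
    move/eqP; rewrite mulf_eq0 => /orP[/eqP/complexI/eqP|/eqP//].
    by rewrite subr_eq0 => /eqP.
  by apply: plus0'; rewrite h v0 oppr0.
move=> t x ht xI; apply: both0; [exact: P|apply: M => //].
by have := tau0; lra.
Qed.

(** The mirror image: the invariant leaving node 2 dies first. *)
Lemma middle_drains_node2 : alpha1 <> k1%:R -> alpha2 = k2%:R - 2 ->
  forall t x, tau + tau + tau <= t -> I01 x -> vlc t e2 x = 0.
Proof.
move=> a1 a2.
have P t x : tau + tau <= t -> I01 x -> rie t e2 (c e2) x = 0.
  apply: (drain_forward tau0) => s hs; apply: plus0'; rewrite node2// a2.
  have -> : k2%:R - 2 - k2%:R + 1 = - 1 :> R by ring.
  by rewrite rmorphN rmorph1 mulN1r.
have M t x : tau + tau + tau <= t -> I01 x -> rie t e2 (- c e2) x = 0.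
  apply: (drain_backward T2) => s hs.
  have ts : tau <= s by have := tau0; lra.
  have h := plus0 (P s 0 hs I01_0); have := node1 ts; rewrite h => h2.
  have v0 : vlc s e2 0 = 0.
    have : (k1%:R - alpha1)%:C * vlc s e2 0 = 0.
      have -> : k1%:R - alpha1 = (k1%:R - 1 - alpha1) + 1 :> R by ring.
      by rewrite [X in X * _]rmorphD rmorph1 mulrDl -h2 mul1r addNr.
    move/eqP; rewrite mulf_eq0 => /orP[/eqP/complexI/eqP|/eqP//].
    by rewrite subr_eq0 => /eqP h'; case: a1.
  by apply: minus0'; rewrite h v0 oppr0.
move=> t x ht xI; apply: both0; [apply: P => //|exact: M].
by have := tau0; lra.
Qed.

(** Once the middle edge is at rest so are both internal nodes, and the
outgoing invariants of the external edges die after a last delay. *)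
Lemma velocity_vanishes :
  (forall t x, tau + tau + tau <= t -> I01 x -> vlc t e2 x = 0) ->
  forall t i x, tau + tau + tau + tau <= t -> I01 x -> vlc t i x = 0.
Proof.
move=> mid t i x ht xI.
have T3 : 0 <= tau + tau + tau by rewrite addr_ge0.
have t3 : tau + tau + tau <= t by have := tau0; lra.
have t1 : tau <= t by have := tau0; lra.
have leaf : (3 <= label i <= N)%N ->
    (forall s, tau + tau + tau <= s -> vlc s i 0 = 0) -> vlc t i x = 0.
  move=> i3 h; apply: both0; first exact: leafT.
  apply: (drain_backward T3) => // s hs.
  have s1 : tau <= s by have := tau0; lra.
  by apply: minus0'; rewrite (plus0 (leafT s1 i3 I01_0)) h// oppr0.
have v1 s : tau + tau + tau <= s -> vlc s e1 1 = 0.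
  move=> hs; have [V' [dV' gE vE]] := dom (le_trans T3 hs).
  have := dom_velocity1 dV' (out1_middle hk1 he2).
  rewrite !vE; [|exact: I01_1|exact: I01_0].
  by rewrite mid//; exact: I01_0.
case: (edgeP hk1 hk2 hN he1 he2 i) => [->|->|i3 io _|i3 io].
- apply: both0; last exact: rootT.
  apply: (drain_forward T3) => // s hs.
  have s1 : tau <= s by have := tau0; lra.
  by apply: plus0'; rewrite (minus0 (rootT s1 I01_1)) v1// oppr0.
- exact: mid.
- apply: leaf => // s hs; have [V' [dV' gE vE]] := dom (le_trans T3 hs).
  have := dom_velocity1 dV' io; rewrite !vE; [|exact: I01_1|exact: I01_0].
  by rewrite v1.
- apply: leaf => // s hs; have [V' [dV' gE vE]] := dom (le_trans T3 hs).
  have := dom_velocity2 dV' io; rewrite !vE; [|exact: I01_1|exact: I01_0].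
  by rewrite mid//; exact: I01_1.
Qed.

End Drain.

Definition const_state : state R N := fun i => (fun=> 1, fun=> 0).

Lemma const_state_kernel :
  domA const_state /\ eqH (AT c const_state) (scaleH 0 const_state).
Proof.
have [h2 cE wE] := cderiv_unique (is_wderiv_cst (1 : R[i])) (is_wderiv_cst 0).
split; first split.
- by move=> i; split => //; exists (fun=> 0); exact: is_wderiv_cst.
- split; last by split.
  have E i x : I01 x -> (c i)%:C * cderiv (const_state i).1 x = 0.
    by move=> xI; rewrite cE// mulr0.
  split; rewrite ?(E _ 0 I01_0) ?(E _ 1 I01_1)//.
  + by move=> i _; rewrite (E _ 1 I01_1) oppr0.
  + rewrite big1 ?subr0 ?mulr0// => i _; exact: (E _ 0 I01_0).
  + rewrite big1 ?subr0 ?mulr0// => i _; exact: (E _ 0 I01_0).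
move=> i; split=> [x _|]; first by rewrite /= mul0r.
by apply: filterS wE => x /= + xI => ->//; rewrite mulr0 mul0r.
Qed.

(** Solving AV = (f - a, g) edge by edge: v = f - a is forced, c^2 u'' = g
determines u' up to a constant on each edge, and u is then glued along the tree.
The external conditions fix the constants of the external edges.  The middle
edge has the single constant m for two node conditions, and the number a is what
makes them compatible; this is possible because constants satisfy the
compatibility condition only if alpha1 + alpha2 = k1 + k2 - 2. *)
Lemma kernel_plus_range U : alpha1 + alpha2 != k1%:R + k2%:R - 2 -> inH U ->
  exists a V, domA V /\ eqH (AT c V) (U - scaleH a const_state).
Proof.
move=> ha hU; have [rU j1 j2] := hU.
pose f i := (U i).1.
pose h i (x : R) : R[i] := ((c i ^+ 2)^-1)%:C * (U i).2 x.
have hL i : L2 (h i) by apply: L2Z; case: (rU i).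
pose G i := primitive0 (h i) 1.
pose C i : R[i] := (c i)%:C.
have C0 i : C i != 0 by apply/eqP => /complexI/eqP; rewrite gt_eqF.
pose L i : R[i] := - f i 1 - C i * G i.
pose D1 := \sum_(i | out1 i) L i - L e2.
pose D2 := \sum_(i | out2 i) L i.
(* a comes from the sum of the two node conditions, m from the second. *)
pose den : R[i] := alpha1%:C + alpha2%:C - (k1%:R + k2%:R - 2).
have den0 : den != 0.
  apply/eqP => /eqP; rewrite subr_eq0 => /eqP E; move/eqP: ha; apply.
  by apply: complexI; rewrite rmorphD E !(rmorphD, rmorphN, rmorph_nat).
pose a := (D1 + D2 - f e1 0 - C e1 * G e1 - C e2 * G e2 + alpha1%:C * f e1 1 +
           alpha2%:C * f e2 1) / den.
pose m := (D2 + (k2%:R - 1) * a - C e2 * G e2 + alpha2%:C * (f e2 1 - a)) / C e2.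
(* The slopes at x = 0; for leaves, C i * p i = L i + a. *)
pose p i := if i == e1 then (f e1 0 - a) / C e1 else if i == e2 then m
            else (L i + a) / C i.
pose sl i x := p i + primitive0 (h i) x.
have slh i : is_wderiv (sl i) (h i) by exact: is_wderiv_primitive0.
have slL i : L2 (sl i) by apply: H1_L2; exists (h i).
pose q1 := primitive0 (sl e1) 1; pose q2 := q1 + primitive0 (sl e2) 1.
pose b i := if i == e1 then 0 else if out1 i then q1 else q2.
pose u i x := b i + primitive0 (sl i) x.
have us i : is_wderiv (u i) (sl i) by exact: is_wderiv_primitive0.
pose v i x := f i x + - a.
have vH i : H1 (v i).
  have [[g hg] _] := rU i.
  exists (fun x => g x + 0); exact: is_wderivD hg (is_wderiv_cst _).
pose V : state R N := fun i => (u i, v i).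
have cd i x : I01 x -> cderiv (V i).1 x = sl i x.
  by move=> xI; have [_ E _] := cderiv_unique (us i) (slh i); exact: E.
have e21 : (e2 == e1) = false.
  by apply/eqP => h21; move: he2; rewrite h21 he1.
have out1e1 : out1 e1 = false by rewrite /Defs.out1 he1.
have out1e2 : out1 e2 by exact: out1_middle.
have u0 i : u i 0 = b i by rewrite /u primitive0_at0 addr0.
have u11 : u e1 1 = q1 by rewrite /u /b eqxx add0r.
have u21 : u e2 1 = q2 by rewrite /u /b e21 out1e2.
have C1 i : C i * cderiv (V i).1 1 = C i * p i + C i * G i.
  by rewrite (cd _ _ I01_1) mulrDr.
have Cz i : C i * cderiv (V i).1 0 = C i * p i.
  by rewrite (cd _ _ I01_0) /sl primitive0_at0 addr0.
have p1 : C e1 * p e1 = f e1 0 - a by rewrite /p eqxx mulrC divfK.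
have p2 : C e2 * p e2 = C e2 * m by rewrite /p e21 eqxx.
have p3 i : (3 <= label i <= N)%N -> C i * p i = L i + a.
  move=> i3; rewrite /p.
  have -> : (i == e1) = false by apply/eqP => ie; move: i3; rewrite ie he1.
  have -> : (i == e2) = false by apply/eqP => ie; move: i3; rewrite ie he2.
  by rewrite mulrC divfK.
have s1 : \sum_(i | out1 i) (c i)%:C * cderiv (V i).1 0 =
    C e2 * m + D1 + (k1 - 2)%:R * a.
  rewrite (eq_bigr (fun i => (C i * p i - L i) + L i)); last first.
    by move=> i _; rewrite subrK; exact: Cz.
  rewrite big_split/= (sum_out1 hk1 hk2 hN he1 he2 (p := a)); last first.
    by move=> i i3 _; rewrite p3//; ring.
  by rewrite p2 /D1; ring.
have s2 : \sum_(i | out2 i) (c i)%:C * cderiv (V i).1 0 =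
    D2 + (k2 - 1)%:R * a.
  rewrite (eq_bigr (fun i => (C i * p i - L i) + L i)); last first.
    by move=> i _; rewrite subrK; exact: Cz.
  rewrite big_split/= (sum_out2 hk1 hk2 hN he1 he2 (p := a)); last first.
    by move=> i i3 _; rewrite p3//; ring.
  by rewrite /D2 addrC.
have mE : C e2 * m = D2 + (k2%:R - 1) * a - C e2 * G e2 + alpha2%:C * (f e2 1 - a).
  by rewrite /m mulrC divfK.
exists a, V; split; first split.
- by move=> i; split; [case: (cderiv_unique (us i) (slh i))|exact: vH].
- split; split.
  + by rewrite -[(c e1)%:C]/(C e1) Cz p1.
  + move=> i i3; rewrite -[(c i)%:C]/(C i) C1 p3// /L /=.
    by rewrite /v; ring.
  + rewrite s1 -[(c e1)%:C]/(C e1) C1 p1 /= /v natrB// mE.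
    have aE : a * den = D1 + D2 - f e1 0 - C e1 * G e1 - C e2 * G e2 +
        alpha1%:C * f e1 1 + alpha2%:C * f e2 1 by rewrite /a divfK.
    apply/eqP; rewrite -subr_eq0; apply/eqP.
    transitivity (D1 + D2 - f e1 0 - C e1 * G e1 - C e2 * G e2 +
        alpha1%:C * f e1 1 + alpha2%:C * f e2 1 - a * den).
      by rewrite /den; ring.
    by rewrite aE subrr.
  + rewrite s2 -[(c e2)%:C]/(C e2) C1 p2 mE /= /v natrB ?(ltnW hk2)//.
    by ring.
  + move=> i io /=; rewrite u0 u11 /v /f j1//; split => //.
    by rewrite /b io; case: eqP => [ie|//]; move: io; rewrite ie out1e1.
  + move=> i io /=; rewrite u0 u21 /v /f j2//; split => //.
    have io1 : out1 i = false.
      by move: io; rewrite /Defs.out2 /Defs.out1; lia.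
    rewrite /b io1; case: eqP => [ie|//]; move: io.
    by rewrite ie /Defs.out2 he1; lia.
- move=> i; split=> [x xI|].
    by rewrite !stateE /= mulr1.
  have [_ _] := cderiv_unique (us i) (slh i).
  apply: filterS => x /= + xI => ->//; rewrite mulr0 oppr0 addr0 /h mulrA -rmorphM.
  by rewrite divff ?mul1r// expf_neq0// gt_eqF.
Qed.

(** Both cases exclude alpha1 + alpha2 = k1 + k2 - 2, so that each state is a
constant a plus some W = AV; then S t fixes the constant, and the first component
of S t W is the velocity of the orbit of V. *)
Lemma finite_time_stability S : C0_semigroup k1 e1 e2 S ->
  generates k1 e1 e2 c alpha1 alpha2 S ->
  (alpha1 = k1%:R - 2 /\ alpha2 <> k2%:R) \/
  (alpha1 <> k1%:R /\ alpha2 = k2%:R - 2) ->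
  finite_time_stable k1 e1 e2 S.
Proof.
move=> HS HG hcase U hU.
have ha : alpha1 + alpha2 != k1%:R + k2%:R - 2.
  apply/eqP => E; case: hcase => [[h1 h2]|[h1 h2]].
    by apply: h2; lra.
  by apply: h1; lra.
have [a [V [dV AV]]] := kernel_plus_range ha hU.
have [dK AK] := const_state_kernel; have hK := dom_inH dK.
set W := U - scaleH a const_state in AV.
have hW : inH W by apply: inHB => //; exact: inHZ.
pose tau := \sum_i (c i)^-1.
have tau0 : 0 <= tau by apply: sumr_ge0 => j _; rewrite invr_ge0 ltW.
exists (tau + tau + tau + tau); first by rewrite !addr_ge0.
exists a => t tT i x xI.
have t0 : 0 <= t by lra.
have vanish : (S t W i).1 x = 0.
  apply: (velocity_vanishes HS HG dV hW AV) => //.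
  case: hcase => -[h1 h2].
    exact: (middle_drains_node1 HS HG dV hW AV h1 h2).
  exact: (middle_drains_node2 HS HG dV hW AV h1 h2).
have UE : U = scaleH a const_state + W.
  by apply: state_eq => j y; rewrite !stateE; ring.
have [+ _] := sg_linear HS a t0 hK hW i; rewrite -UE => /(_ x xI) ->.
rewrite !stateE vanish addr0 (eigen_trajectory HS HG i dK AK xI t0).
by rewrite mul0r cexp0 !mulr1.
Qed.

End FiniteTime.

Theorem proposition4p2 (R : realType) (N k1 k2 : nat)
    (hk1 : (2 <= k1)%N) (hk2 : (2 <= k2)%N) (hN : (k1 + k2 = N + 1)%N)
    (e1 e2 : 'I_N) (he1 : label e1 = 1%N) (he2 : label e2 = 2%N)
    (c : 'I_N -> R) (hc : forall i, 0 < c i)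
    (alpha1 alpha2 : R) (ha1 : alpha1 <> k1%:R) (ha2 : alpha2 <> k2%:R) :
  ((exists lambda : R[i],
       lambda <> 0 /\ is_eigenvalue k1 e1 e2 c alpha1 alpha2 lambda) <->
     (alpha1 <> k1%:R - 2 /\ alpha2 <> k2%:R - 2)) /\
  (alpha1 <> k1%:R - 2 -> alpha2 <> k2%:R - 2 ->
     sigma_d k1 e1 e2 c alpha1 alpha2 =
       [set 0] `|` range (lambda_ k1 k2 (c e2) alpha1 alpha2)) /\
  (forall S, semigroup_of_AT k1 e1 e2 c alpha1 alpha2 S ->
     (alpha1 <> k1%:R - 2 -> alpha2 <> k2%:R - 2 -> ~ finite_time_stable k1 e1 e2 S) /\
     ((alpha1 = k1%:R - 2 /\ alpha2 <> k2%:R) \/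
      (alpha1 <> k1%:R /\ alpha2 = k2%:R - 2) -> finite_time_stable k1 e1 e2 S)).
Proof.
have nz := nonzero_eigenvalueP hk1 hk2 hN he1 he2 hc ha1 ha2.
split; first exact: nz.
split; first exact: spectrumE.
move=> S [HS HG]; split=> [h1 h2|].
  have [lambda [l0 ev]] := nz.2 (conj h1 h2).
  exact: (nonzero_eigenvalue_unstable HS HG l0 ev).
exact: (finite_time_stability hk1 hk2 hN he1 he2 hc HS HG).
Qed.
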